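(* Let $p\ge 2$ be an integer and let $G=G_p$ be the Vilenkin group. Suppose $f\in L_2(G)$ is such that $\|\cdot\|_G\,Ff\in L_2(G)$, and let $$f(x)=\sum_{\nu=1}^{p-1}\sum_{j\in\mathbb{Z}}\sum_{k\in\mathbb{Z}_+}c_{j,k}^{\nu}\psi_{j,k}^{\nu}(x)$$ be the expansion of $f$ in the Haar basis. Then the series $$\sum_{\nu=1}^{p-1}\sum_{j\in\mathbb{Z}}\sum_{k\in\mathbb{Z}_+}|p^jc_{j,k}^{\nu}|^2$$ is convergent.
   Context: The Vilenkin group $G=G_p$ is the set of sequences $x=(x_j)_{j\in\mathbb{Z}}$ with $x_j\in\{0,\dots,p-1\}$ such that $x_j=0$ for all sufficiently negative $j$; the operation $\oplus$ is coordinatewise addition modulo $p$, with inverse operation $\ominus$ and neutral element $\mathbf{0}$. For $x\ne\mathbf{0}$ let $N(x)$ be the unique integer with $x_{N(x)}\neq0$ and $x_j=0$ for $j<N(x)$; set $\|x\|_G=p^{-N(x)}$ and $\|\mathbf{0}\|_G=0$. The metric $\|x\ominus y\|_G$ makes $G$ a locally compact abelian group. Put $I=\{x\in G: x_j=0 \text{ for all } j<0\}$; Haar measure on $G$ is normalized so that $I$ has measure $1$, and $L_q(G)$ denotes the space of complex-valued functions with respect to this measure. Let $\lambda(x)=\sum_{j\in\mathbb{Z}}x_jp^{-j-1}$, a bijection from the set of elements of $G$ not terminating in an infinite string of $(p-1)$'s onto $[0,\infty)$; $\lambda^{-1}$ denotes its inverse on $[0,\infty)$. The dilation $D:G\to G$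 is $(Dx)_k=x_{k+1}$, and $D^j$ denotes its $j$-th iterate, $j\in\mathbb{Z}$. Characters: $\chi(x,\xi)=\exp\left(\frac{2\pi i}{p}\sum_{j\in\mathbb{Z}}x_j\xi_{-1-j}\right)$. Fourier transform: $Ff(\omega)=\int_G f(x)\overline{\chi(x,\omega)}\,dx$ for $f\in L_1(G)$, extended to a unitary operator on $L_2(G)$ in the standard way. Haar functions: let $\varphi=\mathbf{1}_I$ be the characteristic function of $I$, and for $\nu=1,\dots,p-1$ let $$\psi^{\nu}(x)=\sum_{n=0}^{p-1}\exp\left(\frac{2\pi i\nu n}{p}\right)\varphi(Dx\oplus\lambda^{-1}(n)),\qquad \psi^{\nu}_{j,k}(x)=p^{j/2}\psi^{\nu}(D^jx\oplus\lambda^{-1}(k)),$$ for $j\in\mathbb{Z}$, $k\in\mathbb{Z}_+=\{0,1,2,\dots\}$. The system $\{\psi^\nu_{j,k}\}$ is an orthonormal basis (the Haar basis) of $L_2(G)$. *)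

(* Defs.v *)
From HB Require Import structures.
From mathcomp Require Import all_boot all_order all_algebra finmap.
From mathcomp Require Import zify.
From mathcomp Require Import all_classical all_reals all_analysis summability.
From mathcomp Require Import complex.
Set Implicit Arguments.
Unset Strict Implicit.
Unset Printing Implicit Defensive.
Import Order.TTheory GRing.Theory Num.Theory.
Import numFieldNormedType.Exports.
Local Open Scope classical_set_scope.
Local Open Scope ring_scope.
Local Open Scope complex_scope.

Definition left_finite (p : nat) : {pred int -> 'Z_p} :=
  fun x => `[< exists n : int, forall j, j < n -> x j = 0 >].
Arguments left_finite : clear implicits.

(* Digits are read in 'Z_p, which is Z/p because 1 < p.  The real field R is
   a parameter of the type because the metric takes its values in R. *)
Record vilenkin (R : realType) (p : nat) (hp : (1 < p)%N) := Vilenkin {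
  digit :> int -> 'Z_p;
  _ : digit \in left_finite p }.

Section GroupStructure.
Variable p : nat.

Lemma left_finite_zmod_closed : zmod_closed (left_finite p).
Proof.
split; first by apply/asboolP; exists 0.
move=> x y /asboolP[m xm] /asboolP[n yn]; apply/asboolP.
exists (Order.min m n) => j; rewrite lt_min => /andP[jm jn].
by rewrite -[LHS]/(x j - y j) xm// yn// subr0.
Qed.

HB.instance Definition _ :=
  GRing.isZmodClosed.Build (int -> 'Z_p) (left_finite p)
    left_finite_zmod_closed.

Variables (R : realType) (hp : (1 < p)%N).

HB.instance Definition _ := [isSub for @digit R p hp].
HB.instance Definition _ := [Choice of vilenkin R hp by <:].
HB.instance Definition _ := [SubChoice_isSubZmodule of vilenkin R hp by <:].
HB.instance Definition _ := isPointed.Build (vilenkin R hp) 0.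

End GroupStructure.

Section Metric.
Variables (R : realType) (p : nat) (hp : (1 < p)%N).
Implicit Types x y z : vilenkin R hp.

Definition vorder x : int :=
  xget 0 [set n : int | x n != 0 /\ forall j, j < n -> x j = 0].

Definition vnorm x : R := if x == 0 then 0 else p%:R ^ (- vorder x).

Lemma vilenkinP x y : (forall j, x j = y j) -> x = y.
Proof. by move=> xy; apply/val_inj/funext. Qed.

Lemma digitD x y j : (x + y) j = x j + y j. Proof. by []. Qed.
Lemma digitN x j : (- x) j = - x j. Proof. by []. Qed.
Lemma digit0 j : (0 : vilenkin R hp) j = 0. Proof. by []. Qed.

Lemma vorderP x : x != 0 ->
  x (vorder x) != 0 /\ forall j, j < vorder x -> x j = 0.
Proof.
move=> x0; suff : [set n : int | x n != 0 /\ forall j, j < n -> x j = 0] !=set0.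
  by case=> n Hn; rewrite /vorder; case: xgetP => [m _ //|/(_ n)].
have [i xi] : exists i, x i != 0.
  apply: contrapT => /forallNP H; move/eqP: x0; apply; apply: vilenkinP => j.
  by have /negP := H j; rewrite negbK => /eqP.
have [n xn] : exists n : int, forall j, j < n -> x j = 0.
  by case: x {x0 i xi} => d /= /asboolP.
have ex : exists k : nat, x (n + k%:Z) != 0.
  exists `|i - n|%N; suff -> : n + `|i - n|%N%:Z = i by [].
  suff : n <= i by lia.
  by rewrite leNgt; apply: contra xi => /xn ->.
case: (ex_minnP ex) => k xk kmin; exists (n + k%:Z); split => // j jk.
have [/xn//|nj] := ltP j n; apply/eqP/negPn/negP => xj.
have jE : j = n + `|j - n|%N%:Z by lia.
by have := kmin `|j - n|%N; rewrite -jE => /(_ xj); lia.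
Qed.

Let p_gt0 : 0 < p%:R :> R. Proof. by rewrite ltr0n (ltn_trans _ hp). Qed.

Lemma vnorm_ge0 x : 0 <= vnorm x.
Proof. by rewrite /vnorm; case: ifP => // _; rewrite exprz_ge0// ltW. Qed.

Lemma vnorm0 : vnorm 0 = 0. Proof. by rewrite /vnorm eqxx. Qed.

Lemma vnorm_eq0 x : vnorm x = 0 -> x = 0.
Proof.
rewrite /vnorm; case: ifPn => [/eqP //|_ /eqP].
by rewrite expfz_eq0 (gt_eqF p_gt0) andbF.
Qed.

Lemma vnormN x : vnorm (- x) = vnorm x.
Proof.
rewrite /vnorm oppr_eq0; case: ifP => // _; congr (_ ^ (- _)).
rewrite /vorder; congr xget; apply/seteqP; split => n [nx H]; split.
- by move: nx; rewrite digitN oppr_eq0.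
- by move=> j /H; rewrite digitN => /eqP; rewrite oppr_eq0 => /eqP.
- by rewrite digitN oppr_eq0.
- by move=> j /H; rewrite digitN => ->; rewrite oppr0.
Qed.

Lemma vnormD x y : vnorm (x + y) <= Num.max (vnorm x) (vnorm y).
Proof.
wlog xy : x y / vnorm y <= vnorm x.
  move=> H; have /orP[/H//|xy] := le_total (vnorm y) (vnorm x).
  by rewrite addrC maxC; exact: H.
have [->|xy0] := eqVneq (x + y) 0; first by rewrite vnorm0 le_max vnorm_ge0.
have p1 : 1 < p%:R :> R by rewrite ltr1n.
have x0 : x != 0.
  apply: contra_neq xy0 => x0; move: xy; rewrite x0 vnorm0 add0r => y0.
  by apply: vnorm_eq0; apply/eqP; rewrite eq_le y0 vnorm_ge0.
rewrite (max_idPl xy) /vnorm (negbTE xy0) (negbTE x0) ler_eXz2l// lerN2 leNgt.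
apply/negP => H; have [+ _] := vorderP xy0; apply/negP; rewrite negbK.
have [_ xj] := vorderP x0; rewrite digitD xj// add0r.
have [->|y0] := eqVneq y 0; first by rewrite digit0.
have [_ yj] := vorderP y0; rewrite yj// (lt_le_trans H)//.
by move: xy; rewrite /vnorm (negbTE y0) (negbTE x0) ler_eXz2l// lerN2.
Qed.

Definition vdist x y : R := vnorm (x - y).

Fact vdistxx x : vdist x x = 0. Proof. by rewrite /vdist subrr vnorm0. Qed.

Fact vdist_positivity x y : vdist x y = 0 -> x = y.
Proof. by move/vnorm_eq0/eqP; rewrite subr_eq0 => /eqP. Qed.

Fact vdist_sym x y : vdist x y = vdist y x.
Proof. by rewrite /vdist -vnormN opprB. Qed.

Fact vdist_triangle y x z : vdist x z <= vdist x y + vdist y z.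
Proof.
rewrite /vdist -(subrKA y x) (le_trans (vnormD _ _))// ge_max.
by rewrite lerDl lerDr !vnorm_ge0.
Qed.

HB.instance Definition _ := @isMetric.Build R (vilenkin R hp) vdist
  vdistxx vdist_positivity vdist_sym vdist_triangle.

HB.instance Definition _ := Measurable.copy (vilenkin R hp)
  (g_sigma_algebraType (@open (vilenkin R hp))).

End Metric.

Section Dilation.
Variables (R : realType) (p : nat) (hp : (1 < p)%N).
Implicit Types x : vilenkin R hp.

Fact dilate_subproof (i : int) x : (fun k => x (k + i)) \in left_finite p.
Proof.
case: x => d /= /asboolP[n dn]; apply/asboolP; exists (n - i) => j jn.
by apply: dn; rewrite -ltrBrDr.
Qed.

(* The i-th iterate of the dilation, i in Z; dilate0 and dilateD below. *)
Definition dilate (i : int) x : vilenkin R hp :=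
  Vilenkin R hp (dilate_subproof i x).

Lemma dilate0 x : dilate 0 x = x.
Proof. by apply: vilenkinP => k /=; rewrite addr0. Qed.

Lemma dilateD i j x : dilate (i + j) x = dilate i (dilate j x).
Proof. by apply: vilenkinP => k /=; rewrite addrA. Qed.

End Dilation.

Section Lambda.
Variables (R : realType) (p : nat) (hp : (1 < p)%N).
Implicit Types x : vilenkin R hp.

Definition lambda x : \bar R :=
  \esum_(j in [set: int]) ((x j : nat)%:R * p%:R ^ (- j - 1))%:E.

Definition ends_with_max_digits x :=
  exists n : int, forall j, n <= j -> (x j : nat) = p.-1.

(* Inverse of the bijection induced by lambda; the default 0 is used only for
   t < 0. *)
Definition lambda_inv (t : R) : vilenkin R hp :=
  xget 0 [set x | ~ ends_with_max_digits x /\ lambda x = t%:E].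

End Lambda.

Section Analysis.
Variables (R : realType) (p : nat) (hp : (1 < p)%N).
Local Notation G := (vilenkin R hp).

Definition unit_ball : set G := [set x | forall j, j < 0 -> x j = 0].

Definition normalized_haar (mu : {measure set G -> \bar R}) : Prop :=
  (forall (a : G) (A : set G), measurable A -> mu [set a + x | x in A] = mu A)
  /\ mu unit_ball = 1%E.

Definition expi (t : R) : R[i] := cos t +i* sin t.

(* Only finitely many terms of the sum are nonzero. *)
Definition chi (x xi : G) : R[i] :=
  expi (2 * pi / p%:R *
    \sum_(j \in [set: int]) ((x j : nat)%:R * (xi (- 1 - j) : nat)%:R : R)).

Variable mu : {measure set G -> \bar R}.

Definition cintegral (f : G -> R[i]) : R[i] :=
  Rintegral mu setT (fun x => complex.Re (f x))
  +i* Rintegral mu setT (fun x => complex.Im (f x)).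

Definition memL1 (f : G -> R[i]) : Prop :=
  mu.-integrable setT (fun x => (complex.Re (f x))%:E) /\
  mu.-integrable setT (fun x => (complex.Im (f x))%:E).

Definition L2norm (f : G -> R[i]) : \bar R :=
  Lnorm mu 2%:E (fun x => (Normc.normc (f x))%:E).

Definition memL2 (f : G -> R[i]) : Prop :=
  [/\ measurable_fun setT (fun x => complex.Re (f x)),
      measurable_fun setT (fun x => complex.Im (f x)) &
      (L2norm f < +oo)%E].

Definition fourierL1 (f : G -> R[i]) (w : G) : R[i] :=
  cintegral (fun x => f x * (chi x w)^*%C).

(* g is a representative of the image of f under the extension by L2-continuity
   of the Fourier transform from L1 n L2 to L2. *)
Definition is_fourierL2 (f g : G -> R[i]) : Prop :=
  memL2 g /\
  exists fn : nat -> G -> R[i],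
    [/\ forall n, memL1 (fn n) /\ memL2 (fn n),
        L2norm (fn n \- f) @[n --> \oo] --> 0%E &
        L2norm (fourierL1 (fn n) \- g) @[n --> \oo] --> 0%E].

Definition haar_phi (x : G) : R[i] := (\1_unit_ball x)%:C.

Definition haar_psi (nu : nat) (x : G) : R[i] :=
  \sum_(n < p) expi (2 * pi * nu%:R * n%:R / p%:R) *
    haar_phi (dilate 1 x + lambda_inv hp n%:R).

Definition haar (nu : nat) (j : int) (k : nat) (x : G) : R[i] :=
  (p%:R `^ (j%:~R / 2))%:C * haar_psi nu (dilate j x + lambda_inv hp k%:R).

(* The Haar series with coefficients c converges to f in L2; as for any
   orthonormal basis, convergence is that of the net of the finite partial
   sums. *)
Definition is_haar_expansion (f : G -> R[i]) (c : nat -> int -> nat -> R[i]) :=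
  (fun A : {fset nat * int * nat} =>
    L2norm (fun x => f x -
      \sum_(i <- A | (0 < i.1.1 < p)%N)
        c i.1.1 i.1.2 i.2 * haar i.1.1 i.1.2 i.2 x)) @ totally --> 0%E.

End Analysis.

(* Main.v *)
(** The Fourier transform maps the Haar functions to an orthonormal system:
  [haar nu j k] is a unimodular constant times [p^(j/2)] times a character times
  the indicator of a coset of a compact open subgroup, and its transform
  [haar_dual] has the same form, supported in the shell [vnorm w = p^(j+1)].
  By Parseval, [c nu j k = <f, haar nu j k> = <Ff, haar_dual nu j k>], and on
  the shell the weight [vnorm] is the constant [p^(j+1)]; hence
  [p^j c nu j k = p^-1 <vnorm Ff, haar_dual nu j k>], and Bessel's inequality
  for [vnorm Ff] bounds the sum of squares. *)
Require Import Defs.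
From HB Require Import structures.
From mathcomp Require Import all_boot all_order all_algebra finmap.
From mathcomp Require Import all_classical all_reals all_analysis complex.
From mathcomp Require Import measurable_realfun.
From mathcomp Require Import zify ring lra.
Set Implicit Arguments.
Unset Strict Implicit.
Unset Printing Implicit Defensive.
Import Order.TTheory GRing.Theory Num.Theory.
Import numFieldNormedType.Exports.
Local Open Scope classical_set_scope.
Local Open Scope ring_scope.
Local Open Scope complex_scope.

(** * Complex-valued integration *)

(** The transform of [f] is known only through approximating sequences, so Parseval is proved only
    against Haar functions. Each Haar function is the inverse transform of the explicit integrable
    function [haar_dual]; for integrable [u], the identity between the coefficient of [u] and that
    of its transform is then Fubini's theorem, and continuity of the inner product carries it to
    [f]. Orthonormality is checked on the dual side: different pairs [(j, nu)] give disjoint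
    supports, because the leading digit and its position reveal [nu] and [j], and different [k] are
    separated by the orthogonality of characters on a ball. The same Parseval identity brings
    orthonormality back to the Haar functions, which identifies the given [c] with inner products.
    Since [lambda_inv] is chosen by a description, its digits have to be recovered from the value of
    [lambda]; only those of negative index are determined here. *)

Section ComplexParts.
Variable R : realType.
Implicit Types a b : R[i].

Lemma ReD a b : complex.Re (a + b) = complex.Re a + complex.Re b.
Proof. by case: a b => [? ?] []. Qed.
Lemma ImD a b : complex.Im (a + b) = complex.Im a + complex.Im b.
Proof. by case: a b => [? ?] []. Qed.
Lemma ReM a b : complex.Re (a * b) =
  complex.Re a * complex.Re b - complex.Im a * complex.Im b.
Proof. by case: a b => [? ?] []. Qed.
Lemma ImM a b : complex.Im (a * b) =
  complex.Re a * complex.Im b + complex.Im a * complex.Re b.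
Proof. by case: a b => [? ?] []. Qed.
Lemma ReJ a : complex.Re a^*%C = complex.Re a. Proof. by case: a. Qed.
Lemma ImJ a : complex.Im a^*%C = - complex.Im a. Proof. by case: a. Qed.

Lemma conjcM a b : (a * b)^*%C = a^*%C * b^*%C.
Proof. exact: rmorphM. Qed.

Lemma complexP a b : complex.Re a = complex.Re b ->
  complex.Im a = complex.Im b -> a = b.
Proof. by case: a b => [? ?] [? ?] /= -> ->. Qed.

Lemma normc_ge0 a : 0 <= Normc.normc a.
Proof. by case: a => x y; exact: sqrtr_ge0. Qed.

Lemma normc_sqr a :
  Normc.normc a ^+ 2 = complex.Re a ^+ 2 + complex.Im a ^+ 2.
Proof. by case: a => x y; rewrite sqr_sqrtr// addr_ge0// sqr_ge0. Qed.

Lemma normcJ_sqr a : a * a^*%C = (Normc.normc a ^+ 2)%:C.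
Proof.
by rewrite normc_sqr; apply: complexP; rewrite ?(ReM, ImM, ReJ, ImJ)/=; ring.
Qed.

Lemma normc_conj a : Normc.normc a^*%C = Normc.normc a.
Proof. by case: a => x y /=; rewrite sqrrN. Qed.

Lemma normr_Re_le a : `|complex.Re a| <= Normc.normc a.
Proof.
case: a => x y /=; rewrite -(ler_pXn2r (n := 2)) ?nnegrE ?sqrtr_ge0//.
by rewrite sqr_sqrtr ?real_normK ?num_real ?addr_ge0 ?sqr_ge0// lerDl sqr_ge0.
Qed.

Lemma normr_Im_le a : `|complex.Im a| <= Normc.normc a.
Proof.
case: a => x y /=; rewrite -(ler_pXn2r (n := 2)) ?nnegrE ?sqrtr_ge0//.
by rewrite sqr_sqrtr ?real_normK ?num_real ?addr_ge0 ?sqr_ge0// lerDr sqr_ge0.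
Qed.

Lemma normc_le_ReIm a :
  Normc.normc a <= `|complex.Re a| + `|complex.Im a|.
Proof.
case: a => x y /=.
rewrite -(ler_pXn2r (n := 2)) ?nnegrE ?sqrtr_ge0 ?addr_ge0//.
rewrite sqr_sqrtr ?addr_ge0 ?sqr_ge0// -[x ^+ 2]real_normK ?num_real//.
rewrite -[y ^+ 2]real_normK ?num_real//.
by have := normr_ge0 x; have := normr_ge0 y; nra.
Qed.

Lemma normcC (r : R) : Normc.normc r%:C = `|r|.
Proof. by rewrite /= expr0n addr0 sqrtr_sqr. Qed.

End ComplexParts.

Section ComplexMeasurable.
Context d (T : measurableType d) (R : realType).
Implicit Types (u v : T -> R[i]) (a : R[i]).

Definition cmeas u := measurable_fun setT (fun x => complex.Re (u x)) /\
  measurable_fun setT (fun x => complex.Im (u x)).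

Lemma cmeas_cst a : cmeas (fun=> a).
Proof. by split; exact: measurable_cst. Qed.

Lemma cmeasD u v : cmeas u -> cmeas v -> cmeas (fun x => u x + v x).
Proof.
move=> [ru iu] [rv iv]; split.
- by under eq_fun do rewrite ReD; exact: measurable_funD.
- by under eq_fun do rewrite ImD; exact: measurable_funD.
Qed.

Lemma cmeasM u v : cmeas u -> cmeas v -> cmeas (fun x => u x * v x).
Proof.
move=> [ru iu] [rv iv]; split.
- under eq_fun do rewrite ReM.
  by apply: measurable_funB; exact: measurable_funM.
- under eq_fun do rewrite ImM.
  by apply: measurable_funD; exact: measurable_funM.
Qed.

Lemma cmeasJ u : cmeas u -> cmeas (fun x => (u x)^*%C).
Proof.
move=> [ru iu]; split.
- by under eq_fun do rewrite ReJ.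
- by under eq_fun do rewrite ImJ; exact: measurable_funN.
Qed.

Lemma measurable_normc u : cmeas u ->
  measurable_fun setT (fun x => Normc.normc (u x)).
Proof.
move=> [ru iu]; under eq_fun => x.
  rewrite (_ : Normc.normc (u x) =
    ((complex.Re (u x) ^+ 2 + complex.Im (u x) ^+ 2) `^ 2^-1)); last first.
    rewrite -normc_sqr -powR_mulrn ?normc_ge0// -powRrM mulfV//.
    by rewrite powRr1// normc_ge0.
  over.
apply: (@measurableT_comp _ _ _ _ _ _ (@powR R ^~ 2^-1)).
  exact: measurable_powR.
by apply: measurable_funD; exact: measurable_funX.
Qed.

End ComplexMeasurable.

Lemma cmeas_comp d d' (T : measurableType d) (T' : measurableType d')
    (R : realType) (g : T -> T') (u : T' -> R[i]) :
  measurable_fun setT g -> cmeas u -> cmeas (fun x => u (g x)).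
Proof.
move=> mg [ru iu]; split; first exact: (measurableT_comp ru mg).
exact: (measurableT_comp iu mg).
Qed.

(** * Complex integrals, the inner product of L2 and Bessel's inequality *)

Section ComplexIntegral.
Variables (R : realType) (p : nat) (hp : (1 < p)%N).
Local Notation G := (vilenkin R hp).
Implicit Types (u v w : G -> R[i]) (a b : R[i]).

Variable mu : {measure set G -> \bar R}.

Lemma memL1_cmeas u : memL1 mu u -> cmeas u.
Proof.
by move=> [/measurable_int/measurable_EFinP ?
  /measurable_int/measurable_EFinP ?].
Qed.

Lemma memL1_le u (g : G -> R) : cmeas u ->
  mu.-integrable setT (EFin \o g) -> (forall x, Normc.normc (u x) <= g x) ->
  memL1 mu u.
Proof.
move=> [ru iu] ig ug; split.
- apply: le_integrable ig => //; first exact/measurable_EFinP.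
  move=> x _ /=; rewrite lee_fin (le_trans (normr_Re_le _))//.
  by rewrite (le_trans (ug x))// ler_norm.
- apply: le_integrable ig => //; first exact/measurable_EFinP.
  move=> x _ /=; rewrite lee_fin (le_trans (normr_Im_le _))//.
  by rewrite (le_trans (ug x))// ler_norm.
Qed.

Lemma memL1Z a u : memL1 mu u -> memL1 mu (fun x => a * u x).
Proof.
move=> [ru iu]; split.
- under eq_fun do rewrite ReM EFinB !EFinM.
  by apply: integrableB => //; exact: integrableZl.
- under eq_fun do rewrite ImM EFinD !EFinM.
  by apply: integrableD => //; exact: integrableZl.
Qed.

Lemma memL1J u : memL1 mu u -> memL1 mu (fun x => (u x)^*%C).
Proof.
move=> [ru iu]; split.
- by under eq_fun do rewrite ReJ.
- by under eq_fun do rewrite ImJ EFinN; exact: integrableN.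
Qed.

Lemma cintegralD u v : memL1 mu u -> memL1 mu v ->
  cintegral mu (fun x => u x + v x) = cintegral mu u + cintegral mu v.
Proof.
move=> [ru iu] [rv iv]; apply: complexP; rewrite ?(ReD, ImD) /cintegral/=.
- by under eq_Rintegral do rewrite ReD; rewrite RintegralD.
- by under eq_Rintegral do rewrite ImD; rewrite RintegralD.
Qed.

Lemma cintegralZ a u : memL1 mu u ->
  cintegral mu (fun x => a * u x) = a * cintegral mu u.
Proof.
move=> [ru iu]; apply: complexP; rewrite ?(ReM, ImM) /cintegral/=.
- under eq_Rintegral do rewrite ReM.
  rewrite RintegralB//; first by rewrite !RintegralZl.
  + by rewrite /comp; under eq_fun do rewrite EFinM; exact: integrableZl.
  + by rewrite /comp; under eq_fun do rewrite EFinM; exact: integrableZl.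
- under eq_Rintegral do rewrite ImM.
  rewrite RintegralD//; first by rewrite !RintegralZl.
  + by rewrite /comp; under eq_fun do rewrite EFinM; exact: integrableZl.
  + by rewrite /comp; under eq_fun do rewrite EFinM; exact: integrableZl.
Qed.

Lemma cintegralJ u : memL1 mu u ->
  cintegral mu (fun x => (u x)^*%C) = (cintegral mu u)^*%C.
Proof.
move=> [ru iu]; apply: complexP; rewrite ?(ReJ, ImJ) /cintegral/=.
- by under eq_Rintegral do rewrite ReJ.
- under eq_Rintegral do rewrite ImJ -mulN1r.
  by rewrite RintegralZl// mulN1r.
Qed.

Lemma eq_cintegral u v : u =1 v -> cintegral mu u = cintegral mu v.
Proof. by move=> /funext ->. Qed.

(** The factor 2 comes from bounding the real and imaginary parts separately. It is harmless: the
    estimate only serves to pass to limits. *)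
Lemma normc_cintegral_le u (g : G -> R) : memL1 mu u ->
  measurable_fun setT g -> (forall x, Normc.normc (u x) <= g x) ->
  ((Normc.normc (cintegral mu u))%:E <= 2%:E * \int[mu]_x (g x)%:E)%E.
Proof.
move=> [ru iu] mg ug.
apply: (@le_trans _ _ (`|Rintegral mu setT (fun x => complex.Re (u x))|%:E +
    `|Rintegral mu setT (fun x => complex.Im (u x))|%:E)%E).
  by rewrite -EFinD lee_fin normc_le_ReIm.
rewrite (_ : 2%:E = 1%:E + 1%:E)%E; last by rewrite -EFinD.
rewrite ge0_muleDl// !mul1e; apply: leeD.
- rewrite EFin_normr_Rintegral// (le_trans (le_abse_integral _ _ _))//.
    exact: measurable_int (ru).
  apply: ge0_le_integral => //.
  + by apply: measurableT_comp => //; case/integrableP: ru.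
  + exact/measurable_EFinP.
  + by move=> x _; rewrite /= lee_fin (le_trans (normr_Re_le _)).
- rewrite EFin_normr_Rintegral// (le_trans (le_abse_integral _ _ _))//.
    exact: measurable_int (iu).
  apply: ge0_le_integral => //.
  + by apply: measurableT_comp => //; case/integrableP: iu.
  + exact/measurable_EFinP.
  + by move=> x _; rewrite /= lee_fin (le_trans (normr_Im_le _)).
Qed.

Lemma L2norm_ge0 u : (0 <= L2norm mu u)%E. Proof. exact: Lnorm_ge0. Qed.

Lemma L2norm_sqr u :
  (L2norm mu u `^ 2)%E = (\int[mu]_x (Normc.normc (u x) ^+ 2)%:E)%E.
Proof.
rewrite /L2norm poweR_Lnorm//; apply: eq_integral => x _.
by rewrite /= ger0_norm ?normc_ge0// powR_mulrn ?normc_ge0.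
Qed.

Lemma memL2P u : memL2 mu u <-> cmeas u /\
  mu.-integrable setT (fun x => (Normc.normc (u x) ^+ 2)%:E).
Proof.
have e : (\int[mu]_x `|(Normc.normc (u x) ^+ 2)%:E| = L2norm mu u `^ 2)%E.
  rewrite L2norm_sqr; apply: eq_integral => x _.
  by rewrite gee0_abs// lee_fin sqr_ge0.
split=> [[ru iu lu]|[[ru iu] su]].
  have cu : cmeas u by [].
  split=> //; apply/integrableP; split.
    by apply/measurable_EFinP; apply: measurable_funX; exact: measurable_normc.
  by rewrite e; exact: poweR_lty.
split => //; apply: (@lty_poweRy _ _ 2) => //.
by rewrite -e; case/integrableP: su.
Qed.

Lemma memL2_cmeas u : memL2 mu u -> cmeas u.
Proof. by move=> /memL2P[]. Qed.

Lemma memL2_le u (g : G -> R) : cmeas u ->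
  mu.-integrable setT (EFin \o g) ->
  (forall x, Normc.normc (u x) ^+ 2 <= g x) ->
  memL2 mu u.
Proof.
move=> cu ig ug; apply/memL2P; split=> //.
apply: le_integrable ig => //.
  by apply/measurable_EFinP; apply: measurable_funX; exact: measurable_normc.
move=> x _ /=; rewrite lee_fin ger0_norm ?sqr_ge0//.
by rewrite (le_trans (ug x))// ler_norm.
Qed.

Lemma memL2D u v : memL2 mu u -> memL2 mu v -> memL2 mu (fun x => u x + v x).
Proof.
move=> /memL2P[cu iu] /memL2P[mv iv].
apply: (@memL2_le _ (fun x => 2 * Normc.normc (u x) ^+ 2 +
                              2 * Normc.normc (v x) ^+ 2)).
- exact: cmeasD.
- rewrite /comp; under eq_fun do rewrite EFinD !EFinM.
  by apply: integrableD => //; exact: integrableZl.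
- move=> x; rewrite !normc_sqr ReD ImD.
  set a := complex.Re _; set b := complex.Re _.
  set c := complex.Im _; set d := complex.Im _.
  by have := sqr_ge0 (a - b); have := sqr_ge0 (c - d); nra.
Qed.

Lemma memL2Z a u : memL2 mu u -> memL2 mu (fun x => a * u x).
Proof.
move=> /memL2P[cu iu].
apply: (@memL2_le _ (fun x => Normc.normc a ^+ 2 * Normc.normc (u x) ^+ 2)).
- by apply: cmeasM => //; exact: cmeas_cst.
- by rewrite /comp; under eq_fun do rewrite EFinM; exact: integrableZl.
- by move=> x; rewrite Normc.normcM exprMn.
Qed.

Lemma memL2_0 : memL2 mu (fun=> 0).
Proof.
apply/memL2P; split; first exact: cmeas_cst.
by under eq_fun do rewrite Normc.normc0 expr0n; exact: integrable0.
Qed.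

Lemma memL2_sum I (r : seq I) (P : pred I) (U : I -> G -> R[i]) :
  (forall i, P i -> memL2 mu (U i)) ->
  memL2 mu (fun x => \sum_(i <- r | P i) U i x).
Proof.
move=> mU; elim: r => [|i r IH].
  by under eq_fun do rewrite big_nil; exact: memL2_0.
under eq_fun do rewrite big_cons; case: (boolP (P i)) => // Pi.
by apply: memL2D => //; exact: mU.
Qed.

Lemma memL2B u v : memL2 mu u -> memL2 mu v -> memL2 mu (fun x => u x - v x).
Proof.
move=> cu mv; under eq_fun do rewrite -[X in _ + X]mulN1r.
by apply: memL2D => //; exact: memL2Z.
Qed.

Definition ip u v : R[i] := cintegral mu (fun x => u x * (v x)^*%C).

Lemma memL1_ip u v : memL2 mu u -> memL2 mu v ->
  memL1 mu (fun x => u x * (v x)^*%C).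
Proof.
move=> /memL2P[cu iu] /memL2P[mv iv].
apply: (@memL1_le _ (fun x => Normc.normc (u x) ^+ 2 + Normc.normc (v x) ^+ 2)).
- by apply: cmeasM => //; exact: cmeasJ.
- by rewrite /comp; under eq_fun do rewrite EFinD; exact: integrableD.
- move=> x; rewrite Normc.normcM normc_conj.
  by have := normc_ge0 (u x); have := normc_ge0 (v x); nra.
Qed.

Lemma normc_ip_le u v : memL2 mu u -> memL2 mu v ->
  ((Normc.normc (ip u v))%:E <= 2%:E * (L2norm mu u * L2norm mu v))%E.
Proof.
move=> hu hv; have [cu mv] := (memL2_cmeas hu, memL2_cmeas hv).
have [nu nv] := (measurable_normc cu, measurable_normc mv).
apply: le_trans (normc_cintegral_le (memL1_ip hu hv) _ _) _.
- exact: measurable_funM nu nv.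
- by move=> x; rewrite Normc.normcM normc_conj.
rewrite lee_pmul2l//.
(* Cauchy-Schwarz, as Hölder's inequality with both exponents equal to 2. *)
apply: le_trans (@hoelder _ _ _ mu _ _ 2 2 nu nv _ _ _) => //.
  rewrite Lnorm1; apply: ge0_le_integral => //.
  - by move=> x _; rewrite lee_fin mulr_ge0// normc_ge0.
  - by apply/measurable_EFinP; exact: measurable_funM.
  - by apply/measurable_EFinP/measurableT_comp => //; exact: measurable_funM.
  - by move=> x _; rewrite lee_fin ler_norm.
by rewrite [RHS]splitr !div1r.
Qed.

Lemma ipDl u v w : memL2 mu u -> memL2 mu v -> memL2 mu w ->
  ip (fun x => u x + v x) w = ip u w + ip v w.
Proof.
move=> hu hv hw; rewrite /ip -cintegralD; [|exact: memL1_ip..].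
by apply: eq_cintegral => x; rewrite mulrDl.
Qed.

Lemma ipZl a u v : memL2 mu u -> memL2 mu v ->
  ip (fun x => a * u x) v = a * ip u v.
Proof.
move=> hu hv; rewrite /ip -cintegralZ; last exact: memL1_ip.
by apply: eq_cintegral => x; rewrite mulrA.
Qed.

Lemma ipC u v : memL2 mu u -> memL2 mu v -> ip u v = (ip v u)^*%C.
Proof.
move=> hu hv; rewrite /ip -cintegralJ; last exact: memL1_ip.
by apply: eq_cintegral => x; rewrite rmorphM/= conjcK mulrC.
Qed.

Lemma ipBl u v w : memL2 mu u -> memL2 mu v -> memL2 mu w ->
  ip (fun x => u x - v x) w = ip u w - ip v w.
Proof.
move=> hu hv hw; under eq_fun do rewrite -[X in _ + X]mulN1r.
by rewrite ipDl ?ipZl ?mulN1r//; exact: memL2Z.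
Qed.

Lemma ipBr u v w : memL2 mu u -> memL2 mu v -> memL2 mu w ->
  ip u (fun x => v x - w x) = ip u v - ip u w.
Proof.
move=> hu hv hw; rewrite ipC ?ipBl//; last exact: memL2B.
by rewrite rmorphB -[LHS]/(_^*%C - _^*%C) -!ipC.
Qed.

Lemma ip_suml I (r : seq I) (P : pred I) (U : I -> G -> R[i]) v :
  (forall i, P i -> memL2 mu (U i)) -> memL2 mu v ->
  ip (fun x => \sum_(i <- r | P i) U i x) v = \sum_(i <- r | P i) ip (U i) v.
Proof.
move=> hU hv; elim: r => [|i r IH].
  rewrite big_nil; under eq_fun do rewrite big_nil.
  (* The empty sum is written as a multiple of [v], so that [ipZl] yields 0. *)
  rewrite -[LHS](_ : ip (fun x => 0 * v x) v = _).
    by rewrite ipZl// mul0r.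
  by apply: eq_cintegral => x; rewrite mul0r.
under eq_fun do rewrite big_cons; rewrite big_cons.
case: (boolP (P i)) => // Pi.
by rewrite ipDl ?IH//; [exact: hU|exact: (memL2_sum r hU)].
Qed.

Lemma ip_self_ge0 u : 0 <= complex.Re (ip u u).
Proof. by apply: Rintegral_ge0 => x _; rewrite normcJ_sqr/= sqr_ge0. Qed.

(** With [s] the orthogonal projection of [u] on the span of the [e i], both [ip u s] and [ip s s]
    equal the sum of squares, so the claim is the positivity of [ip (u - s) (u - s)]. *)
Lemma bessel (I : eqType) (r : seq I) (e : I -> G -> R[i]) u :
  uniq r -> memL2 mu u -> (forall i, i \in r -> memL2 mu (e i)) ->
  {in r &, forall i j, ip (e i) (e j) = (i == j)%:R} ->
  \sum_(i <- r) Normc.normc (ip u (e i)) ^+ 2 <= complex.Re (ip u u).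
Proof.
move=> ur hu he oe.
(* The filter [i \in r] records the membership under which [he] applies. *)
pose s x := \sum_(i <- r | i \in r) ip u (e i) * e i x.
have hs : memL2 mu s.
  by apply: (@memL2_sum _ r (mem r)) => i ir; apply: memL2Z; exact: he.
have ips v : memL2 mu v -> ip s v = \sum_(i <- r) ip u (e i) * ip (e i) v.
  move=> hv; rewrite ip_suml//; last by move=> i ir; apply: memL2Z; exact: he.
  by rewrite -big_seq; apply: eq_big_seq => i ir; rewrite ipZl//; exact: he.
have us : ip u s = (\sum_(i <- r) Normc.normc (ip u (e i)) ^+ 2)%:C.
  rewrite ipC// ips// !rmorph_sum; apply: eq_big_seq => i ir.
  rewrite rmorphM -[LHS]/(_^*%C * _^*%C).
  by rewrite -(ipC hu (he _ ir)) mulrC normcJ_sqr.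
have ss : ip s s = (\sum_(i <- r) Normc.normc (ip u (e i)) ^+ 2)%:C.
  rewrite ips// rmorph_sum; apply: eq_big_seq => i ir.
  have -> : ip (e i) s = (ip u (e i))^*%C.
    rewrite (ipC (he _ ir) hs) ips; last exact: he.
    congr (conjc _); rewrite (bigD1_seq i ir ur)/= oe// eqxx mulr1.
    rewrite big_seq_cond big1 ?addr0// => j /andP[jr ji].
    by rewrite oe// (negbTE ji) mulr0.
  by rewrite normcJ_sqr.
have := ip_self_ge0 (fun x => u x - s x).
rewrite ipBl ?ipBr//; last exact: memL2B.
rewrite (ipC hs hu) us ss !ReD conjc_real/=; case: (ip u u) => a b /=.
by rewrite subrr oppr0 addr0 subr_ge0.
Qed.

End ComplexIntegral.

(** * Characters and Haar measure *)

Section Characters.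
Variables (R : realType) (p : nat) (hp : (1 < p)%N).
Local Notation G := (vilenkin R hp).
Implicit Types (x y z w : G) (s t : R).

Lemma expiD s t : expi (s + t) = expi s * expi t.
Proof.
by apply: complexP; rewrite ?(ReM, ImM)/= ?cosD// sinD addrC; congr (_ + _);
  rewrite mulrC.
Qed.

Lemma expi0 : expi (0 : R) = 1.
Proof. by apply: complexP; rewrite /= ?cos0 ?sin0. Qed.

Lemma expiN t : expi (- t) = (expi t)^*%C.
Proof. by rewrite /expi cosN sinN. Qed.

Lemma expi_conj t : expi t * (expi t)^*%C = 1.
Proof. by rewrite -expiN -expiD subrr expi0. Qed.

Lemma normc_expi t : Normc.normc (expi t) = 1.
Proof. by rewrite /= cos2Dsin2 sqrtr1. Qed.

(** The real part is [1 - 2 sin(t/2)^2], and [sin] is positive at [t/2], which lies strictly between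
    0 and [pi]. *)
Lemma expi_neq1 t : 0 < t < 2 * pi -> expi t != 1.
Proof.
move=> /andP[t0 tpi]; apply/eqP => /(congr1 (@complex.Re _)) /=.
have -> : t = t / 2 + t / 2 by rewrite -splitr.
rewrite cosD -!expr2; have := cos2Dsin2 (t / 2).
have : 0 < sin (t / 2) by apply: sin_gt0_pi; apply/andP; split; lra.
by nra.
Qed.

Let p_gt0 : 0 < p%:R :> R. Proof. by rewrite ltr0n (ltn_trans _ hp). Qed.

Definition unit_root (n : nat) : R[i] := expi (2 * pi / p%:R * n%:R).

Lemma unit_rootD m n : unit_root (m + n) = unit_root m * unit_root n.
Proof. by rewrite /unit_root natrD mulrDr expiD. Qed.

Lemma unit_root_mod n : unit_root (n %% p) = unit_root n.
Proof.
suff e k : unit_root (k * p) = 1.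
  by rewrite [in RHS](divn_eq n p) unit_rootD e mul1r.
rewrite /unit_root natrM mulrCA divfK ?gt_eqF// mulrC.
elim: k => [|k IH]; first by rewrite mulr0 expi0.
rewrite -[in k.+1%:R]natr1 mulrDr mulr1 expiD IH mul1r /expi mulr_natl.
by rewrite cos2pi sin2pi.
Qed.

(** The digit is read as a natural number; since [unit_root] has period [p], this is the standard
    additive character of ['Z_p]. *)
Definition zroot (a : 'Z_p) := unit_root a.

Lemma zroot_nat n : zroot n%:R = unit_root n.
Proof. by rewrite /zroot val_Zp_nat// unit_root_mod. Qed.

Lemma zrootD a b : zroot (a + b) = zroot a * zroot b.
Proof.
by rewrite -{1}(natr_Zp a) -{1}(natr_Zp b) -natrD zroot_nat unit_rootD.
Qed.

Lemma zroot_neq1 a : a != 0 -> zroot a != 1.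
Proof.
move=> a0; apply: expi_neq1; have ap : (a < p)%N.
  by have := ltn_ord a; rewrite [X in (_ < X)%N](Zp_cast hp).
have a1 : (0 < a)%N.
  by rewrite lt0n; apply: contra a0 => /eqP a0; apply/eqP/val_inj.
have pi0 := @pi_gt0 R.
apply/andP; split; first by rewrite !mulr_gt0 ?invr_gt0// ltr0n.
rewrite mulrAC ltr_pdivrMr// ltr_pM2l ?ltr_nat// mulr_gt0//.
Qed.

Lemma digits_lt x : exists N : nat, forall j, j < - N%:Z -> x j = 0.
Proof.
case: x => d /= /[dup] /asboolP[n dn] _; exists `|n|%N => j jn; apply: dn.
by lia.
Qed.

Definition below N x := forall j, j < - (N%:Z) -> x j = 0.

Lemma below_le M N x : (M <= N)%N -> below M x -> below N x.
Proof. by move=> MN h j jN; apply: h; lia. Qed.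

Lemma below_ex3 x y z : exists N, [/\ below N x, below N y & below N z].
Proof.
have [K xK] := digits_lt x; have [M yM] := digits_lt y.
have [N zN] := digits_lt z; exists (maxn K (maxn M N)).
by split; [apply: below_le xK|apply: below_le yM|apply: below_le zN]; lia.
Qed.

Lemma chi_trunc N x w : below N x -> below N w ->
  chi x w = expi (2 * pi / p%:R *
    \sum_(i < N + N) ((x (i%:Z - N%:Z) : nat)%:R *
      (w (N%:Z - 1 - i%:Z) : nat)%:R)).
Proof.
move=> xN wN; congr (expi (_ * _)).
(* The indices from [-N] to [N - 1]: to the left of them the digit of [x] vanishes, to the right
   that of [w], because then [-1 - j < -N]. *)
pose r : seq int := [seq i%:Z - N%:Z | i <- index_iota 0 (N + N)].
rewrite (fsbigE r)//.
- rewrite big_map big_mkcond/= big_mkord; apply: eq_bigr => i _.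
  by rewrite in_setT; congr (_ * (nat_of_ord (w _))%:R); lia.
- by rewrite map_inj_uniq ?iota_uniq// => i j; lia.
- move=> j _ jr; have [jN|Nj] := ltP j (- N%:Z).
    by rewrite xN// mul0r.
  rewrite [X in _ * X](_ : _ = 0) ?mulr0// wN//.
  suff : ~~ (j < N%:Z) by lia.
  apply: contra jr => jN; apply/mapP; exists (absz (j + N%:Z)); last by lia.
  by rewrite mem_index_iota; lia.
Qed.

(** The exponent of [chi] reduced modulo [p]. Digits read as natural numbers are not additive, but
    in ['Z_p] the sum is bilinear, which makes [chi] multiplicative. *)
Definition pairing N x w : 'Z_p :=
  \sum_(i < N + N) x (i%:Z - N%:Z) * w (N%:Z - 1 - i%:Z).

Lemma chi_pairing N x w : below N x -> below N w ->
  chi x w = zroot (pairing N x w).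
Proof.
move=> xN wN; rewrite (chi_trunc xN wN).
under eq_bigr do rewrite -natrM; rewrite -natr_sum -/(unit_root _) -zroot_nat.
congr zroot; rewrite natr_sum; apply: eq_bigr => i _.
by rewrite natrM !natr_Zp.
Qed.

Lemma belowD N x y : below N x -> below N y -> below N (x + y).
Proof. by move=> xN yN j jN; rewrite digitD xN// yN// addr0. Qed.

Lemma chiDl x y w : chi (x + y) w = chi x w * chi y w.
Proof.
have [N [xN yN wN]] := below_ex3 x y w.
rewrite !(@chi_pairing N)//; last exact: belowD.
rewrite -zrootD; congr zroot; rewrite -big_split/=; apply: eq_bigr => i _.
by rewrite mulrDl.
Qed.

Lemma chiC x w : chi x w = chi w x.
Proof.
congr (expi (_ * _)).
rewrite (@reindex_fsbigT _ _ _ _ _ (fun j : int => - 1 - j))/=.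
  by apply: eq_fsbigr => j _; rewrite mulrC opprB addrCA subrr addr0.
by exists (fun j : int => - 1 - j) => j; lia.
Qed.

Lemma chiDr x w z : chi x (w + z) = chi x w * chi x z.
Proof. by rewrite chiC chiDl !(chiC x). Qed.

Lemma chi0l w : chi 0 w = 1 :> R[i].
Proof.
rewrite /chi (_ : \sum_(_ \in _) _ = 0) ?mulr0 ?expi0//.
by apply: fsbig1 => j _; rewrite digit0 mul0r.
Qed.

Lemma chi_conj x w : chi x w * (chi x w)^*%C = 1. Proof. exact: expi_conj. Qed.

Lemma normc_chi x w : Normc.normc (chi x w) = 1. Proof. exact: normc_expi. Qed.

Lemma chiNl x w : chi (- x) w = (chi x w)^*%C.
Proof.
by rewrite -[LHS]mul1r -(chi_conj x w) mulrAC -chiDl subrr chi0l mul1r.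
Qed.

Lemma chiNr x w : chi x (- w) = (chi x w)^*%C.
Proof. by rewrite chiC chiNl chiC. Qed.

Fact single_digit_subproof (i : int) (a : 'Z_p) :
  (fun k => if k == i then a else 0) \in left_finite p.
Proof. by apply/asboolP; exists i => j ji; rewrite lt_eqF. Qed.

Definition single_digit (i : int) (a : 'Z_p) : G :=
  Vilenkin R hp (single_digit_subproof i a).

Lemma single_digitE i a k :
  single_digit i a k = if k == i then a else 0.
Proof. by []. Qed.

Lemma chi_single x i a : chi x (single_digit i a) = zroot (x (- 1 - i) * a).
Proof.
rewrite -[x _]natr_Zp -[X in _ * X]natr_Zp -natrM zroot_nat.
rewrite /unit_root natrM; congr (expi (_ * _)).
rewrite (fsbigE [:: - 1 - i])//.
- by rewrite big_mkcond big_seq1 in_setT/= opprB addrCA subrr addr0 eqxx.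
- move=> j _; rewrite inE => ji /=; case: eqP => [e|]; last by rewrite mulr0.
  by move: ji; rewrite -e; lia.
Qed.

(* The subgroup [dilate j I] of measure [p^j], whose annihilator is
   [big_ball (- j)]. *)
Definition big_ball (j : int) : set G := [set z | forall i, i < - j -> z i = 0].

Lemma big_ball0 : big_ball 0 = @unit_ball R p hp.
Proof. by rewrite /big_ball oppr0. Qed.

Lemma big_ballD j x y : big_ball j x -> big_ball j y -> big_ball j (x + y).
Proof. by move=> hx hy i ij; rewrite digitD hx// hy// addr0. Qed.

Lemma big_ballN j x : big_ball j (- x) <-> big_ball j x.
Proof.
split=> h i ij; last by rewrite digitN h// oppr0.
by apply/eqP; rewrite -oppr_eq0 -digitN h.
Qed.

(** At every index [i] one factor is 0: the digit of [z] if [i < j], otherwise that of [w], since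
    then [-1 - i < -j]. *)
Lemma chi_big_ball j z w : big_ball (- j) z -> big_ball j w -> chi z w = 1.
Proof.
move=> hz hw; rewrite /chi (_ : \sum_(_ \in _) _ = 0) ?mulr0 ?expi0//.
apply: fsbig1 => i _; have [ij|ji] := ltP i j.
  by rewrite hz ?mul0r//; lia.
by rewrite hw ?mulr0//; lia.
Qed.

(** A nonzero digit of [z] at some [i < j] is detected by the element whose only digit is 1, at the
    paired index [-1 - i]. *)
Lemma chi_big_ball_neq1 j z : ~ big_ball (- j) z ->
  exists w, big_ball j w /\ chi z w != 1.
Proof.
rewrite /big_ball opprK => /existsNP[i /not_implyP[ij /eqP zi]].
exists (single_digit (- 1 - i) 1); split.
  by move=> k kj /=; case: eqP => // ki; exfalso; lia.
by rewrite chi_single opprB addrCA subrr addr0 mulr1; exact: zroot_neq1.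
Qed.

(** The dilation is self-adjoint for the pairing: shift the summation index by [i]. *)
Lemma chi_dilate i x w : chi (dilate i x) w = chi x (dilate i w).
Proof.
congr (expi (_ * _)).
rewrite (@reindex_fsbigT _ _ _ _ _ (fun j : int => j - i))/=.
  by apply: eq_fsbigr => j _; rewrite subrK opprB addrA addrAC.
by exists (fun j : int => j + i) => j; lia.
Qed.

End Characters.

(** * Measurability, translation invariance and integrals of characters over balls *)

Section HaarMeasure.
Variables (R : realType) (p : nat) (hp : (1 < p)%N).
Local Notation G := (vilenkin R hp).
Implicit Types (x y z w : G) (s t : R).

Let p_gt0 : 0 < p%:R :> R. Proof. by rewrite ltr0n (ltn_trans _ hp). Qed.
Let p_neq0 : p%:R != 0 :> R. Proof. by rewrite gt_eqF. Qed.

Lemma vnorm_lt z (i j : int) : vnorm z < p%:R ^ (- j) -> i <= j -> z i = 0.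
Proof.
rewrite /vnorm; case: ifPn => [/eqP -> _ _|z0]; first exact: digit0.
rewrite ltr_eXz2l ?ltr1n// ltrN2 => jz ij.
by have [_] := vorderP z0; apply; exact: le_lt_trans jz.
Qed.

Lemma ball_vdist x (e : R) : ball x e = [set y | vdist x y < e].
Proof. by rewrite ballEmdist. Qed.

Lemma measurable_open (A : set G) : open A -> measurable A.
Proof. exact: sub_sigma_algebra. Qed.

Lemma open_vdist (A : set G) : (forall x, A x ->
  exists2 e : R, 0 < e & forall y, vdist x y < e -> A y) -> open A.
Proof.
move=> h; rewrite openE => x /h[e e0 eA].
by apply/nbhs_ballP; exists e => //= y; rewrite ball_vdist => /eA.
Qed.

(** Translations are isometries, so preimages of open sets are open. *)
Lemma measurable_translate (a : G) : measurable_fun setT (fun x => a + x).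
Proof.
apply: (measurability (@open G)) => // _ [A oA <-].
rewrite setTI; apply: measurable_open; apply: open_vdist => x /= Ax.
have : nbhs (a + x) A by exact: open_nbhs_nbhs.
move=> /nbhs_ballP[e /= e0 eA].
exists e => // y xy; apply: eA; rewrite ball_vdist/= /vdist.
by rewrite opprD addrACA subrr add0r.
Qed.

Lemma measurable_digit j (a : 'Z_p) : measurable [set x : G | x j = a].
Proof.
apply: measurable_open; apply: open_vdist => x /= xa.
(* Points at distance less than [p ^ (- j)] agree up to and including index [j]. *)
exists (p%:R ^ (- j)) => [|y xy]; first exact: exprz_gt0.
 have := vnorm_lt xy (lexx j).
by rewrite digitD digitN xa => /eqP; rewrite subr_eq0 => /eqP.
Qed.

Lemma measurable_fun_digit j :
  measurable_fun setT (fun x : G => ((x j : nat)%:R : R)).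
Proof.
have -> : (fun x : G => ((x j : nat)%:R : R)) =
    (fun x => \sum_(a : 'Z_p) (a : nat)%:R * \1_[set x : G | x j = a] x).
  apply/funext => x; rewrite (bigD1 (x j))//= big1 ?addr0.
    by rewrite indicE mem_set ?mulr1.
  move=> a ax; rewrite indicE memNset ?mulr0//= => /eqP.
  by rewrite eq_sym (negbTE ax).
apply: measurable_sum => a; apply: measurable_funM => //.
by apply: measurable_indic; exact: measurable_digit.
Qed.

Lemma measurable_big_ball j : measurable (@big_ball R p hp j).
Proof.
have -> : @big_ball R p hp j =
    \bigcap_(n in [set: nat]) [set x : G | x (- j - 1 - n%:Z) = 0].
  apply/seteqP; split=> x /= hx; first by move=> n _; apply: hx; lia.
  move=> i ij; have -> : i = - j - 1 - (absz (- j - 1 - i)%R)%:Z by lia.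
  exact: hx.
by apply: bigcap_measurable => // n _; exact: measurable_digit.
Qed.

(** Fubini asks for measurability with respect to the product sigma-algebra. It holds because [chi]
    is the pointwise limit of functions of finitely many digits, a sequence that is eventually
    constant at each point. *)
Lemma cmeas_chi2 : cmeas (fun z : G * G => chi z.1 z.2).
Proof.
pose T (N : nat) (z : G * G) : R := 2 * pi / p%:R *
    \sum_(i < N + N) ((z.1 (i%:Z - N%:Z) : nat)%:R *
      (z.2 (N%:Z - 1 - i%:Z) : nat)%:R).
have mT N : measurable_fun setT (T N).
  apply: measurable_funM => //; apply: measurable_sum => i.
  apply: measurable_funM.
  - exact: (measurableT_comp (measurable_fun_digit _) measurable_fst).
  - exact: (measurableT_comp (measurable_fun_digit _) measurable_snd).
have Tlim (z : G * G) : \forall N \near \oo, expi (T N z) = chi z.1 z.2.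
  have [N [zN1 zN2 _]] := below_ex3 z.1 z.2 0.
  exists N => // M /= NM; rewrite (@chi_trunc _ _ _ M)//; exact: below_le NM _.
split.
- apply: (@measurable_fun_cvg _ _ _ _ (fun N (z : G * G) => cos (T N z))).
  + move=> N; apply: measurableT_comp => //.
    by apply: continuous_measurable_fun; exact: continuous_cos.
  + move=> z _; apply: cvg_near_cst; near=> N.
    by rewrite -(near (Tlim z) N).
- apply: (@measurable_fun_cvg _ _ _ _ (fun N (z : G * G) => sin (T N z))).
  + move=> N; apply: measurableT_comp => //.
    by apply: continuous_measurable_fun; exact: continuous_sin.
  + move=> z _; apply: cvg_near_cst; near=> N.
    by rewrite -(near (Tlim z) N).
Unshelve. all: by end_near. Qed.

Lemma cmeas_chi z : cmeas (fun x : G => chi z x).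
Proof.
exact: (cmeas_comp (measurable_pair1 z) cmeas_chi2).
Qed.

Variable mu : {measure set G -> \bar R}.
Hypothesis haar_mu : normalized_haar mu.

Lemma pushforward_translate (a : G) (A : set G) : measurable A ->
  pushforward mu (fun x => a + x) A = mu A.
Proof.
move=> mA; rewrite -(haar_mu.1 (- a) _ mA); congr (mu _).
apply/seteqP; split=> [x /= Ax|_ /= [x Ax <-]];
  last by rewrite addrA subrr add0r.
by exists (a + x) => //; rewrite addrA addNr add0r.
Qed.

(** Change of variables for signed functions presupposes that the composite is integrable; this is
    settled first by the nonnegative version applied to the absolute value. *)
Lemma integrable_translate (a : G) (f : G -> \bar R) :
  mu.-integrable setT f -> mu.-integrable setT (fun x => f (a + x)).
Proof.
move=> /integrableP[mf lf]; apply/integrableP; split.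
  exact: (measurableT_comp mf (measurable_translate a)).
have mt := measurable_translate a.
have mabs : measurable_fun setT (fun x => `|f x|%E) by exact: measurableT_comp.
have := ge0_integral_pushforward mt mu measurableT mabs (fun _ _ => abse_ge0 _).
rewrite preimage_setT /comp => <-; rewrite (le_lt_trans _ lf)// le_eqVlt.
apply/orP; left; apply/eqP; apply: eq_measure_integral => A mA _.
exact: pushforward_translate.
Qed.

Lemma integral_translate (a : G) (f : G -> \bar R) : mu.-integrable setT f ->
  (\int[mu]_x f (a + x)%R = \int[mu]_x f x)%E.
Proof.
move=> intf; have mf := measurable_int _ intf.
have mt := measurable_translate a.
have := integral_pushforward mt mf (integrable_translate a intf) measurableT.
rewrite preimage_setT /comp => <-.
apply: eq_measure_integral => A mA _; exact: pushforward_translate.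
Qed.

Lemma cintegral_translate a u : memL1 mu u ->
  cintegral mu (fun x => u (a + x)) = cintegral mu u.
Proof.
move=> [ru iu]; apply: complexP; congr fine.
- exact: (integral_translate a ru).
- exact: (integral_translate a iu).
Qed.

(** The larger ball splits, according to the digit at [-j - 1], into [p] disjoint translates [F a]
    of the smaller one. *)
Lemma mu_big_ballS (j : int) : (mu (@big_ball R p hp (j + 1)) =
  p%:R%:E * mu (@big_ball R p hp j))%E.
Proof.
pose F (a : 'Z_p) :=
  [set single_digit R hp (- j - 1) a + x | x in @big_ball R p hp j].
have FE (a : 'Z_p) : F a =
    @big_ball R p hp (j + 1) `&` [set x : G | x (- j - 1) = a].
  apply/seteqP; split=> [_ [x hx <-]|x [hx xa]].
    split => [i ij|].
      rewrite digitD single_digitE hx; last by lia.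
      by rewrite addr0; case: eqP => // ?; exfalso; lia.
    change ((single_digit R hp (- j - 1) a + x : G) (- j - 1) = a).
    by rewrite digitD single_digitE eqxx hx ?addr0//; lia.
  exists (- single_digit R hp (- j - 1) a + x);
    last by rewrite addrA subrr add0r.
  move=> i ij; rewrite digitD digitN single_digitE.
  case: eqP => [->|ne]; first by rewrite xa addNr.
  by rewrite hx ?oppr0 ?add0r//; lia.
have mF a : measurable (F a).
  rewrite FE; apply: measurableI; last exact: measurable_digit.
  exact: measurable_big_ball.
have -> : @big_ball R p hp (j + 1) =
    \big[setU/set0]_(a < (Zp_trunc p).+2) F a.
  rewrite -bigcup_mkord_ord; apply/seteqP; split=> [x hx|x [a _]].
    by exists (x (- j - 1) : nat); rewrite /= ?inord_val ?FE//=; exact: ltn_ord.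
  by rewrite FE => -[].
rewrite measure_bigsetU_ord//.
- have muF a : mu (F a) = mu (@big_ball R p hp j).
    by apply: haar_mu.1; exact: measurable_big_ball.
  rewrite (eq_bigr _ (fun a _ => muF a)) big_const_ord (Zp_cast hp) mule_natl.
  have iterE n : (iter n (adde (mu (@big_ball R p hp j))) 0 =
      mu (@big_ball R p hp j) *+ n)%E.
    by elim: n => [|n IH]; rewrite ?mule0n// muleS iterS IH.
  exact: iterE.
- by move=> a b _ _ [x []]; rewrite !FE => -[_ xa] [_ xb]; rewrite -xa -xb.
Qed.

Lemma mu_big_ball (j : int) : mu (@big_ball R p hp j) = (p%:R ^ j)%:E.
Proof.
have up k : mu (@big_ball R p hp k) = (p%:R ^ k)%:E ->
    mu (@big_ball R p hp (k + 1)) = (p%:R ^ (k + 1))%:E.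
  by move=> hk; rewrite mu_big_ballS hk -EFinM expfzDr// expr1z mulrC.
(* The measure is an extended real, so the factor [p] is removed by multiplying with its inverse. *)
have down k : mu (@big_ball R p hp (k + 1)) = (p%:R ^ (k + 1))%:E ->
    mu (@big_ball R p hp k) = (p%:R ^ k)%:E.
  rewrite mu_big_ballS => hk.
  rewrite -[LHS]mul1e -(mulVf p_neq0) EFinM -muleA hk -EFinM.
  by rewrite expfzDr// expr1z mulrCA mulVf// mulr1.
have H0 : mu (@big_ball R p hp 0) = (p%:R ^ 0)%:E.
  by rewrite big_ball0 haar_mu.2 expr0z.
elim/int_ind: j => // n.
- by move/up; rewrite -PoszD addn1.
- by move=> h; apply: down; have -> : - n.+1%:Z + 1 = - n%:Z by lia.
Qed.

(** The character of frequency [a] cut off to the coset [-b + big_ball j]. Up to scalars, this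
    family contains the Haar functions and their transforms, and it is stable under modulation and
    under the Fourier transform. *)
Definition wave (j : int) (b a z : G) : R[i] :=
  (\1_(@big_ball R p hp j) (b + z))%:C * chi a z.

Lemma waveE j b a z : wave j b a z =
  if b + z \in @big_ball R p hp j then chi a z else 0.
Proof. by rewrite /wave indicE; case: ifP; rewrite ?mul1r ?mul0r. Qed.

Lemma normc_wave j b a z :
  Normc.normc (wave j b a z) = \1_(@big_ball R p hp j) (b + z).
Proof. by rewrite /wave Normc.normcM normc_chi mulr1 normcC ger0_norm. Qed.

Lemma integrable_ball j b :
  mu.-integrable setT (fun z => (\1_(@big_ball R p hp j) (b + z))%:E).
Proof.
apply: (@integrable_translate b (fun z => (\1_(@big_ball R p hp j) z)%:E)).
apply/integrableP; split.
  apply/measurable_EFinP; apply: measurable_indic.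
  exact: measurable_big_ball.
under eq_integral => x _ do rewrite gee0_abs ?lee_fin//.
rewrite integral_indic//; last exact: measurable_big_ball.
by rewrite setIT mu_big_ball ltry.
Qed.

Lemma cmeas_wave j b a : cmeas (wave j b a).
Proof.
apply: cmeasM; last exact: cmeas_chi.
split => /=; last exact: measurable_cst.
by apply/measurable_EFinP; exact: measurable_int (integrable_ball j b).
Qed.

Lemma memL1_wave j b a : memL1 mu (wave j b a).
Proof.
apply: (memL1_le (cmeas_wave j b a) (integrable_ball j b)) => z.
by rewrite normc_wave.
Qed.

Lemma memL2_wave j b a : memL2 mu (wave j b a).
Proof.
apply: (memL2_le (cmeas_wave j b a) (integrable_ball j b)) => z.
by rewrite normc_wave indicE; case: (_ \in _); rewrite ?expr1n ?expr0n.
Qed.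

(** Orthogonality of characters on a compact group: if [a] annihilates the ball, the integrand is
    its indicator; otherwise translating by some [w] in the ball with [chi a w != 1] multiplies the
    integral by [chi a w], so it is 0. *)
Lemma cintegral_wave0 j a : cintegral mu (wave j 0 a) =
  (p%:R ^ j * \1_(@big_ball R p hp (- j)) a)%:C.
Proof.
have [ain|anin] := boolP (a \in @big_ball R p hp (- j)).
  rewrite indicE ain mulr1.
  rewrite (@eq_cintegral _ _ _ mu _ (fun z => (\1_(@big_ball R p hp j) z)%:C)).
    apply: complexP; rewrite /cintegral/=; last first.
      by rewrite /Rintegral integral0.
    rewrite /Rintegral integral_indic//; last exact: measurable_big_ball.
    by rewrite setIT mu_big_ball.
  move=> z; rewrite /wave add0r indicE.
  have [zin|_] := boolP (z \in _); last by rewrite mul0r.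
  by rewrite (@chi_big_ball _ _ _ j) ?mulr1// -inE.
rewrite indicE (negbTE anin) mulr0.
have [w [wj chiw]] : exists w, @big_ball R p hp j w /\ chi a w != 1.
  by apply: chi_big_ball_neq1; rewrite notin_setE in anin.
have e : cintegral mu (wave j 0 a) = chi a w * cintegral mu (wave j 0 a).
  rewrite -cintegralZ; last exact: memL1_wave.
  rewrite -(cintegral_translate w); last exact: memL1_wave.
  apply: eq_cintegral => z; rewrite !waveE !add0r.
  have -> : (w + z \in @big_ball R p hp j) = (z \in @big_ball R p hp j).
    apply/idP/idP; rewrite !inE => h; last exact: big_ballD.
    rewrite -[z](addKr w); apply: big_ballD => //; exact/big_ballN.
  by case: ifP; rewrite ?mulr0// chiDr.
apply/eqP; move/eqP: e; rewrite -subr_eq0 -{1}[cintegral _ _]mul1r -mulrBl.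
by rewrite mulf_eq0 subr_eq0 eq_sym (negbTE chiw).
Qed.

Lemma cintegral_wave j b a : cintegral mu (wave j b a) =
  (p%:R ^ j * \1_(@big_ball R p hp (- j)) a)%:C * (chi a b)^*%C.
Proof.
rewrite -cintegral_wave0 mulrC -cintegralZ; last exact: memL1_wave.
rewrite -(cintegral_translate (- b)); last exact: memL1_wave.
apply: eq_cintegral => z; rewrite /wave addrA subrr add0r chiDr chiNr.
by rewrite mulrCA mulrA.
Qed.

End HaarMeasure.

(** * Parseval's identity *)

(* Fubini's theorem is stated for bundled sigma-finite measures; the alias gives
   a place to attach that structure to a measure proved to be sigma-finite. *)
Definition sigma_finite_copy d (T : measurableType d) (R : realType)
  (mu : {measure set T -> \bar R}) (sf : sigma_finite setT mu) :
  set T -> \bar R := mu.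

Section SigmaFiniteCopy.
Context d (T : measurableType d) (R : realType)
  (mu : {measure set T -> \bar R}) (sf : sigma_finite setT mu).
HB.instance Definition _ := Measure.copy (sigma_finite_copy sf) mu.
HB.instance Definition _ :=
  Measure_isSigmaFinite.Build d T R (sigma_finite_copy sf) sf.
End SigmaFiniteCopy.

(** An equality of bundled measures, so that a goal about [mu] can be rewritten into one about a
    sigma-finite [m]. *)
Lemma sigma_finite_measureP d (T : measurableType d) (R : realType)
    (mu : {measure set T -> \bar R}) : sigma_finite setT mu ->
  exists m : {sigma_finite_measure set T -> \bar R},
    (m : {measure set T -> \bar R}) = mu.
Proof. by move=> sf; exists (sigma_finite_copy sf); case: mu sf. Qed.

Section Parseval.
Variables (R : realType) (p : nat) (hp : (1 < p)%N).
Local Notation G := (vilenkin R hp).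
Variable m : {sigma_finite_measure set G -> \bar R}.
Implicit Types (u v : G -> R[i]).

Lemma measurable_Rintegral2 (f : G * G -> R) : measurable_fun setT f ->
  measurable_fun setT (fun w => Rintegral m setT (fun x => f (x, w))).
Proof.
move=> mf; have mEf : measurable_fun setT (EFin \o f) by exact/measurable_EFinP.
apply: measurableT_comp; first exact: fine_measurable.
under eq_fun do rewrite integralE.
apply: emeasurable_funB.
- rewrite [X in measurable_fun _ X](_ : _ = fubini_G m (EFin \o f)^\+%E).
    apply: measurable_fun_fubini_tonelli_G; first exact: measurable_funepos.
    by move=> z; exact: funepos_ge0.
  by apply/funext => w; apply: eq_integral => x _; rewrite !funeposE.
- rewrite [X in measurable_fun _ X](_ : _ = fubini_G m (EFin \o f)^\-%E).
    apply: measurable_fun_fubini_tonelli_G; first exact: measurable_funeneg.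
    by move=> z; exact: funeneg_ge0.
  by apply/funext => w; apply: eq_integral => x _; rewrite !funenegE.
Qed.

(** Integrability of every section makes each inner integral finite, so that [fine] can be undone
    pointwise. *)
Lemma Rintegral_fubini (f : G * G -> R) :
  (m \x m)%E.-integrable setT (EFin \o f) ->
  (forall x, m.-integrable setT (fun w => (f (x, w))%:E)) ->
  (forall w, m.-integrable setT (fun x => (f (x, w))%:E)) ->
  Rintegral m setT (fun x => Rintegral m setT (fun w => f (x, w))) =
  Rintegral m setT (fun w => Rintegral m setT (fun x => f (x, w))).
Proof.
move=> intf i1 i2; rewrite /Rintegral.
under eq_integral do rewrite fineK ?integrable_fin_num//.
rewrite (Fubini intf); congr fine; apply: eq_integral => w _.
by rewrite fineK//; exact: integrable_fin_num.
Qed.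

Lemma cintegral_fubini (K : G * G -> R[i]) (u v : G -> R) : cmeas K ->
  m.-integrable setT (EFin \o u) -> m.-integrable setT (EFin \o v) ->
  (forall x w, Normc.normc (K (x, w)) <= u x * v w) ->
  cintegral m (fun x => cintegral m (fun w => K (x, w))) =
  cintegral m (fun w => cintegral m (fun x => K (x, w))).
Proof.
move=> mK iu iv Kuv.
have [rK iK] := mK.
have mu_meas : measurable_fun setT u.
  by apply/measurable_EFinP; exact: (measurable_int m).
have mv_meas : measurable_fun setT v.
  by apply/measurable_EFinP; exact: (measurable_int m).
have memx x : memL1 m (fun w => K (x, w)).
  apply: (@memL1_le _ _ _ _ _ (fun w => u x * v w)) => //.
    exact: (cmeas_comp (measurable_pair1 x) mK).
  by rewrite /comp; under eq_fun do rewrite EFinM; exact: integrableZl.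
have memw w : memL1 m (fun x => K (x, w)).
  apply: (@memL1_le _ _ _ _ _ (fun x => u x * v w)) => //.
    exact: (cmeas_comp (measurable_pair2 w) mK).
  by rewrite /comp; under eq_fun do rewrite EFinM; exact: integrableZr.
(* By Tonelli, the integral of the absolute value of [g] is at most the product of those of [u] and
   [v]. *)
have prodint (g : G * G -> R) : measurable_fun setT g ->
    (forall x w, `|g (x, w)| <= u x * v w) ->
    (m \x m)%E.-integrable setT (EFin \o g).
  move=> mg gle; apply/integrable12ltyP; first exact/measurable_EFinP.
  apply: (@le_lt_trans _ _ (\int[m]_x \int[m]_w (`|u x| * `|v w|)%:E)%E).
    apply: ge0_le_integral => //.
    - by move=> x _; exact: integral_ge0.
    - apply: (@measurable_fun_fubini_tonelli_F _ _ _ _ _ m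
        (fun z : G * G => `|(EFin \o g) z|%E)) => //.
      by apply: measurableT_comp => //; exact/measurable_EFinP.
    - apply: (@measurable_fun_fubini_tonelli_F _ _ _ _ _ m
        (fun z : G * G => (`|u z.1| * `|v z.2|)%:E)) => //.
      apply/measurable_EFinP.
      apply: measurable_funM; apply: measurableT_comp => //.
      + exact: measurableT_comp.
      + exact: measurableT_comp.
    move=> x _; apply: ge0_le_integral => //.
    - apply: measurableT_comp => //; apply/measurable_EFinP.
      exact: (measurableT_comp mg (measurable_pair1 x)).
    - apply/measurable_EFinP; apply: measurable_funM => //.
      exact: measurableT_comp.
    - by move=> w _; rewrite /= lee_fin (le_trans (gle x w))// -normrM ler_norm.
  have nv : m.-integrable setT (fun w => (`|v w|)%:E) by exact: integrable_norm.
  have nu : m.-integrable setT (fun w => (`|u w|)%:E) by exact: integrable_norm.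
  pose V := Rintegral m setT (fun w => `|v w|).
  rewrite (eq_integral (fun x => V%:E * (`|u x|)%:E)%E).
    have /integrableP[_] := integrableZl measurableT V nu.
    apply: le_lt_trans; apply: ge0_le_integral => //.
    - by move=> x _; rewrite mule_ge0// lee_fin Rintegral_ge0.
    - by apply: measurable_funeM; exact: (measurable_int m).
    - apply: measurableT_comp => //; apply: measurable_funeM.
      exact: (measurable_int m).
    - by move=> x _; exact: lee_abs.
  move=> x _; under eq_integral do rewrite EFinM.
  rewrite integralZl// muleC; congr (_ * _)%E.
  by rewrite /Rintegral fineK//; exact: integrable_fin_num.
apply: complexP; rewrite /cintegral/=.
- apply: (Rintegral_fubini (f := fun z => complex.Re (K z))).
  + by apply: prodint => // x w; rewrite (le_trans (normr_Re_le _)).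
  + by move=> x; case: (memx x).
  + by move=> w; case: (memw w).
- apply: (Rintegral_fubini (f := fun z => complex.Im (K z))).
  + by apply: prodint => // x w; rewrite (le_trans (normr_Im_le _)).
  + by move=> x; case: (memx x).
  + by move=> w; case: (memw w).
Qed.

Lemma cmeas_fourier_kernel u : cmeas u ->
  cmeas (fun z : G * G => u z.1 * (chi z.1 z.2)^*%C).
Proof.
move=> cu; apply: cmeasM; first exact: (cmeas_comp measurable_fst cu).
exact/cmeasJ/cmeas_chi2.
Qed.

Lemma cmeas_fourierL1 u : cmeas u -> cmeas (fourierL1 m u).
Proof.
move=> /cmeas_fourier_kernel[rK iK]; split.
- exact: (measurable_Rintegral2 rK).
- exact: (measurable_Rintegral2 iK).
Qed.

Lemma integrable_normc u : memL1 m u ->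
  m.-integrable setT (EFin \o (fun x => Normc.normc (u x))).
Proof.
move=> hu; have [ru iu] := hu.
apply: (@le_integrable _ _ _ _ _ _ _
  (fun x => `|complex.Re (u x)|%:E + `|complex.Im (u x)|%:E)%E) => //.
- by apply/measurable_EFinP; exact/measurable_normc/(memL1_cmeas hu).
- move=> x _; rewrite -EFinD /= lee_fin [leLHS]ger0_norm ?normc_ge0//.
  by rewrite (le_trans (normc_le_ReIm _))// ler_norm.
- by apply: integrableD => //; exact: integrable_norm.
Qed.

(* [fourierL1 m v (- x)] is the inverse Fourier transform of [v] at [x]. *)
Lemma parsevalL1 u v : memL1 m u -> memL1 m v ->
  cintegral m (fun x => u x * (fourierL1 m v (- x))^*%C) =
  cintegral m (fun w => fourierL1 m u w * (v w)^*%C).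
Proof.
move=> hu hv.
have L1chi (f : G -> R[i]) w : memL1 m f ->
    memL1 m (fun x => f x * (chi x w)^*%C).
  move=> hf; apply: (memL1_le _ (integrable_normc hf)).
    apply: cmeasM; first exact: memL1_cmeas hf.
    by under eq_fun do rewrite chiC; exact/cmeasJ/cmeas_chi.
  by move=> x; rewrite Normc.normcM normc_conj normc_chi mulr1.
(* Both sides are iterated integrals of [K], whose modulus is the product of those of [u] and [v]
   because [chi] is unimodular. *)
pose K z : R[i] := u z.1 * (chi z.1 z.2)^*%C * (v z.2)^*%C.
have -> : cintegral m (fun x => u x * (fourierL1 m v (- x))^*%C) =
    cintegral m (fun x => cintegral m (fun w => K (x, w))).
  apply: eq_cintegral => x; rewrite -cintegralJ; last exact: L1chi.
  rewrite -cintegralZ; last by apply: memL1J; exact: L1chi.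
  apply: eq_cintegral => w; rewrite /K chiNr conjcK rmorphM.
  by rewrite mulrA mulrAC (chiC w).
rewrite (cintegral_fubini _ (integrable_normc hu) (integrable_normc hv)).
- apply: eq_cintegral => w; rewrite [RHS]mulrC -cintegralZ; last exact: L1chi.
  by apply: eq_cintegral => x; rewrite mulrC.
- apply: cmeasM; first exact/cmeas_fourier_kernel/(memL1_cmeas hu).
  apply: cmeasJ; exact: (cmeas_comp measurable_snd (memL1_cmeas hv)).
- move=> x w; by rewrite /K !Normc.normcM !normc_conj normc_chi mulr1.
Qed.

End Parseval.

(** * The digits of [lambda_inv] at natural numbers *)

Section LambdaInverse.
Variables (R : realType) (p : nat) (hp : (1 < p)%N).
Local Notation G := (vilenkin R hp).
Implicit Types (x : G) (N : nat).

Let p_gt0 : 0 < p%:R :> R. Proof. by rewrite ltr0n (ltn_trans _ hp). Qed.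
Let p_neq0 : p%:R != 0 :> R. Proof. by rewrite gt_eqF. Qed.

Lemma digit_ltn x j : (x j < p)%N.
Proof. by have := ltn_ord (x j); rewrite [X in (_ < X)%N](Zp_cast hp). Qed.

Definition int_part N x : nat :=
  (\sum_(i < N) (x (- 1 - i%:Z)%R : nat) * p ^ i)%N.

Definition frac_part N x : R :=
  \sum_(i < N) (x i%:Z : nat)%:R * p%:R ^- i.+1.

Lemma frac_part_ge0 N x : 0 <= frac_part N x.
Proof.
by apply: sumr_ge0 => i _; rewrite mulr_ge0// invr_ge0 exprn_ge0// ltW.
Qed.

(** A digit is at most [p - 1]; in this form the bounds telescope when summed over [i]. *)
Lemma frac_part_term (n : nat) i : (n < p)%N ->
  n%:R * p%:R ^- i.+1 <= p%:R ^- i - p%:R ^- i.+1 :> R.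
Proof.
move=> np; rewrite [X in X - _](_ : _ = p%:R * p%:R ^- i.+1); last first.
  by rewrite exprS invfM mulrA mulfV// mul1r.
rewrite -[X in _ - X]mul1r -mulrBl ler_pM2r ?invr_gt0 ?exprn_gt0//.
by rewrite lerBrDr natr1 ler_nat.
Qed.

Lemma frac_part_le N x : frac_part N x <= 1 - p%:R ^- N.
Proof.
elim: N => [|N IH]; first by rewrite /frac_part big_ord0 expr0 invr1 subrr.
rewrite /frac_part big_ord_recr/= -/(frac_part N x).
by have := frac_part_term N (digit_ltn x N%:Z); lra.
Qed.

Lemma frac_part_lt l N x : (l < N)%N -> (x l%:Z : nat) != p.-1 ->
  frac_part N x <= 1 - p%:R ^- l.+1.
Proof.
(* The claim is strengthened by [p ^- N] so that the induction on [N] telescopes. *)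
move=> lN xl; suff : frac_part N x <= 1 - p%:R ^- l.+1 - p%:R ^- N.
  by have : 0 < p%:R ^- N :> R; [rewrite invr_gt0 exprn_gt0|lra].
elim: N lN => // N IH; rewrite ltnS leq_eqVlt => /predU1P[<-|lN].
  rewrite /frac_part big_ord_recr/= -/(frac_part l x).
  have xl1 : ((x l%:Z : nat).+1 < p)%N.
    have := digit_ltn x l%:Z; rewrite leq_eqVlt => /predU1P[e|//].
    by move: xl; rewrite -[in p.-1]e eqxx.
  have := frac_part_term l xl1; rewrite -natr1 mulrDl mul1r.
  by have := frac_part_le l x; lra.
rewrite /frac_part big_ord_recr/= -/(frac_part N x).
by have := IH lN; have := frac_part_term N (digit_ltn x N%:Z); lra.
Qed.

Lemma int_part_below M N x : below M x -> (M <= N)%N ->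
  int_part N x = int_part M x.
Proof.
move=> xM /subnK <-; elim: (N - M)%N => // n IH.
rewrite addSn /int_part big_ord_recr/= -/(int_part _ x) IH.
by rewrite xM ?addn0//; lia.
Qed.

(** The integers from [-N] to [N - 1], listed as two blocks so that a sum over them splits into the
    integer and the fractional part. *)
Let window N : seq int :=
  map (fun i : nat => - 1 - i%:Z : int) (index_iota 0 N) ++
  map (fun i : nat => i%:Z : int) (index_iota 0 N).

Let mem_window N (j : int) : (j \in window N) = (- N%:Z <= j < N%:Z).
Proof.
rewrite mem_cat; apply/idP/idP => [/orP[]|].
- by move/mapP; case=> i; rewrite mem_index_iota => /andP[_ iN] ->; lia.
- by move/mapP; case=> i; rewrite mem_index_iota => /andP[_ iN] ->; lia.
- move=> /andP[Nj jN]; have [j0|j0] := ltP j 0;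
    apply/orP; [left|right]; apply/mapP.
    by exists (absz (- 1 - j)%R); rewrite ?mem_index_iota; lia.
  by exists (absz j); rewrite ?mem_index_iota; lia.
Qed.

Let uniq_window N : uniq (window N).
Proof.
rewrite cat_uniq !map_inj_uniq ?iota_uniq/=; last 2 first.
- by move=> i j; lia.
- by move=> i j; lia.
rewrite andbT; apply/hasPn => _ /mapP[i _ ->]; apply/negP => /mapP[j _].
by lia.
Qed.

Let sum_window N x :
  (\sum_(j \in [set` window N]) ((x j : nat)%:R * p%:R ^ (- j - 1) : R)%:E)%E =
  ((int_part N x)%:R + frac_part N x)%:E.
Proof.
rewrite -fsbig_seq ?uniq_window// sumEFin big_cat !big_map !big_mkord/=.
congr (_ + _)%:E.
- rewrite natr_sum; apply: eq_bigr => i _; rewrite natrM natrX.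
  by congr (_ * _); rewrite exprnP; congr (_ ^ _); lia.
- by apply: eq_bigr => i _; congr (_ * _); rewrite exprnN; congr (_ ^ _); lia.
Qed.

Lemma lambda_ge N x : (((int_part N x)%:R + frac_part N x)%:E <= lambda x)%E.
Proof.
rewrite -sum_window; apply: esum_ge; exists [set` window N] => //.
by split => //; exact: finite_seq.
Qed.

(** Every finite index set lies in a window and the terms are nonnegative, so the windows alone
    determine the supremum defining [lambda]. *)
Lemma lambda_le x (B : R) :
  (forall N, (int_part N x)%:R + frac_part N x <= B) ->
  (lambda x <= B%:E)%E.
Proof.
move=> hB; apply: ge_ereal_sup => _ [A [finA _] <-].
have [N AN] : exists N, A `<=` [set` window N].
  exists (\max_(j <- fset_set A) (absz j).+1)%N => j Aj /=.
  rewrite mem_window.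
  set M := (\max_(_ <- _) _)%N.
  suff : ((absz j).+1 <= M)%N by lia.
  by rewrite /M; apply: leq_bigmax_seq; rewrite ?in_fset_set ?inE.
apply: (@le_trans _ _ ((int_part N x)%:R + frac_part N x)%:E);
  last by rewrite lee_fin.
rewrite -sum_window; apply: lee_fsum_nneg_subset => //.
- exact: finite_seq.
- by move=> j; rewrite !inE; exact: AN.
- by move=> j _; rewrite lee_fin mulr_ge0// exprz_ge0// ltW.
Qed.

Lemma digit_sum N k : (\sum_(i < N) (k %/ p ^ i %% p) * p ^ i = k %% p ^ N)%N.
Proof.
have p0 : (0 < p)%N by exact: ltn_trans hp.
elim: N => [|N IH]; first by rewrite big_ord0 expn0 modn1.
rewrite big_ord_recr/= IH [in RHS](divn_eq k (p ^ N)).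
rewrite [in RHS](divn_eq (k %/ p ^ N) p).
rewrite mulnDl -mulnA -expnS -addnA modnMDl [RHS]modn_small.
  by rewrite addnC.
have rlt : (k %% p ^ N < p ^ N)%N by rewrite ltn_pmod// expn_gt0 p0.
apply: (@leq_trans ((k %/ p ^ N %% p).+1 * p ^ N)%N).
  by rewrite mulSn addnC ltn_add2r.
by rewrite expnS leq_mul2r ltn_pmod// orbT.
Qed.

Fact nat_digits_subproof k : (fun j : int => if j < 0
   then (k %/ p ^ absz (- 1 - j)%R)%:R else 0 : 'Z_p) \in left_finite p.
Proof.
(* To the left of this index the exponent [-1 - j] exceeds [k], and [k < p ^ k] makes the quotient
   0. *)
apply/asboolP; exists (- k%:Z - 1) => j jk; case: ifP => // _.
rewrite divn_small//; apply: leq_trans (ltn_expl _ hp) _.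
by rewrite leq_exp2l//; lia.
Qed.

Definition nat_digits k : G := Vilenkin R hp (nat_digits_subproof k).

Lemma int_part_nat_digits N k : int_part N (nat_digits k) = (k %% p ^ N)%N.
Proof.
rewrite -digit_sum; apply: eq_bigr => i _; congr (_ * _)%N.
rewrite /= ifT; last by lia.
rewrite (_ : absz _ = i); last by lia.
by rewrite val_Zp_nat.
Qed.

Lemma frac_part_nat_digits N k : frac_part N (nat_digits k) = 0.
Proof. by rewrite /frac_part big1// => i _ /=; rewrite mul0r. Qed.

Lemma lambda_nat_digits k : lambda (nat_digits k) = k%:R%:E.
Proof.
apply/eqP; rewrite eq_le; apply/andP; split.
  apply: lambda_le => N; rewrite int_part_nat_digits frac_part_nat_digits.
  by rewrite addr0 ler_nat leq_mod.
apply: le_trans (lambda_ge k _).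
rewrite int_part_nat_digits frac_part_nat_digits.
by rewrite addr0 modn_small// ltn_expl.
Qed.

(* [lambda x] lies in the half-open interval of length 1 starting at the integer
   part, because some digit of nonnegative index is not maximal. *)
Lemma lambda_inv_nat k : exists N, below N (lambda_inv hp k%:R : G) /\
  int_part N (lambda_inv hp k%:R : G) = k.
Proof.
rewrite /lambda_inv; case: xgetP => [x _ [nmax lx]|]; last first.
  (* The default value of [xget] is excluded: [nat_digits k] is a preimage of [k], and its digits of
     nonnegative index are 0, which differs from [p - 1]. *)
  move=> /(_ (nat_digits k))[]; split; last exact: lambda_nat_digits.
  move=> [n /(_ (Num.max n 0))]; rewrite le_max lexx => /(_ isT) /=.
  by rewrite ltNge le_max lexx orbT/=; lia.
have [N xN] := digits_lt x; exists N; split => //.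
have [l /eqP xl] : exists l : nat, (x l%:Z : nat) <> p.-1.
  apply: contrapT => /forallNP H; apply: nmax; exists 0 => j j0.
  by rewrite -(gez0_abs j0); apply: contrapT; exact: H.
apply/eqP; rewrite eqn_leq; apply/andP; split.
  rewrite -(ler_nat R) -lee_fin -lx; apply: le_trans (lambda_ge N x).
  by rewrite lee_fin lerDl frac_part_ge0.
suff : (lambda x <= ((int_part N x)%:R + (1 - p%:R ^- l.+1))%:E)%E.
  rewrite lx lee_fin => h; rewrite -ltnS -(ltr_nat R) -natr1.
  have : 0 < p%:R ^- l.+1 :> R by rewrite invr_gt0 exprn_gt0.
  by move=> c0; rewrite (le_lt_trans h)// ltrD2l ltrBlDr ltrDl.
(* At a window of size [K] the integer part has stabilized and the non-maximal digit at [l] is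
   included; the parts at [M] are bounded by those at [K]. *)
apply: lambda_le => M; pose K := maxn M (maxn N l.+1).
apply: lerD.
  rewrite ler_nat -(int_part_below (N := K) xN); last by rewrite /K; lia.
  rewrite /int_part.
  rewrite -!(big_mkord xpredT (fun i => (x (- 1 - i%:Z)%R : nat) * p ^ i)%N).
  rewrite [leqRHS](big_cat_nat (n := M))//=; last by rewrite /K; lia.
  by rewrite leq_addr.
apply: le_trans (_ : _ <= frac_part K x) _; last first.
  by apply: frac_part_lt => //; rewrite /K; lia.
rewrite /frac_part.
rewrite -!(big_mkord xpredT (fun i => (x i%:Z : nat)%:R * p%:R ^- i.+1)).
rewrite [leRHS](big_cat_nat (n := M))//=; last by rewrite /K; lia.
by rewrite lerDl sumr_ge0// => i _; rewrite mulr_ge0// invr_ge0 exprn_ge0// ltW.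
Qed.

(** Elements of the same coset of the unit ball share their digits of negative index, hence their
    integer parts. *)
Lemma lambda_inv_inj k k' :
  big_ball 0 (lambda_inv hp k%:R - lambda_inv hp k'%:R : G) -> k = k'.
Proof.
have [N [xN ek]] := lambda_inv_nat k; have [N' [xN' ek']] := lambda_inv_nat k'.
move=> h; pose K := maxn N N'; rewrite -ek -ek'.
rewrite -(int_part_below (N := K) xN); last by rewrite /K; lia.
rewrite -(int_part_below (N := K) xN'); last by rewrite /K; lia.
apply: eq_bigr => i _; congr (nat_of_ord _ * _)%N.
by apply/eqP; rewrite -subr_eq0 -digitN -digitD h//; lia.
Qed.

(** A nonzero digit to the left of [-1] would alone contribute at least [p] to the integer part. *)
Lemma lambda_inv_digit n : (n < p)%N ->
  (forall j, j < - 1 -> (lambda_inv hp n%:R : G) j = 0) /\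
  (lambda_inv hp n%:R : G) (- 1) = n%:R.
Proof.
move=> np; have [N [xN]] := lambda_inv_nat n.
set x := (lambda_inv hp n%:R : G).
rewrite -(int_part_below (N := N.+1) xN)// /int_part big_ord_recl/=.
rewrite expn0 muln1 subr0 => e; have p0 : (0 < p)%N by exact: ltn_trans hp.
have xj (j : int) : j < - 1 -> x j = 0.
  move=> j1; have [/xN//|jN] := ltP j (- N%:Z).
  (* The term of index -1 has been split off, so [j] is reached at position [-2 - j] of the
     remaining sum. *)
  have iN : (absz (- 2 - j)%R < N)%N by lia.
  apply/eqP/negPn/negP => xj0.
  have : (0 < x j)%N.
    by rewrite lt0n; apply: contra xj0 => /eqP ?; apply/eqP/val_inj.
  move: e; rewrite (bigD1 (Ordinal iN))//= /bump/= (_ : - 1 - _ = j); last lia.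
  rewrite expnS => e xj_gt0.
  have ple : (p <= x j * (p * p ^ absz (- 2 - j)%R))%N.
    by rewrite mulnCA leq_pmulr// muln_gt0 xj_gt0 expn_gt0 p0.
  move: np; rewrite -e ltnNge => /negP; apply.
  by rewrite (leq_trans ple)// addnCA leq_addr.
split => //; rewrite -[LHS]natr_Zp; congr (_%:R); rewrite -[RHS]e.
rewrite big1 ?addn0// => i _; rewrite xj ?mul0n//.
Qed.

End LambdaInverse.

(** * Fourier transforms of the Haar functions *)

Section HaarFourier.
Variables (R : realType) (p : nat) (hp : (1 < p)%N).
Local Notation G := (vilenkin R hp).
Implicit Types (x z w a b : G) (nu k : nat) (j : int).

Let p_gt0 : 0 < p%:R :> R. Proof. by rewrite ltr0n (ltn_trans _ hp). Qed.
Let p_neq0 : p%:R != 0 :> R. Proof. by rewrite gt_eqF. Qed.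

Definition haar_shift j k : G := dilate (- j) (lambda_inv hp k%:R).
Definition haar_freq j nu : G := single_digit R hp (- 1 - j) nu%:R.

Lemma single_digitN i (d : 'Z_p) :
  - single_digit R hp i d = single_digit R hp i (- d).
Proof.
apply: vilenkinP => j; rewrite digitN !single_digitE.
by case: ifP => // _; rewrite oppr0.
Qed.

(** The terms of the defining sum have disjoint supports: the term of index [n] is nonzero only for
    [x] in the unit ball with zeroth digit [-n]. *)
Lemma haar_psiE nu x : haar_psi nu x =
  (\1_(@big_ball R p hp 0) x)%:C * chi (- haar_freq 0 nu) x.
Proof.
pose m : nat := - x 0; have mp : (m < p)%N by exact: (digit_ltn (- x) 0).
have phiE (n : 'I_p) : haar_phi (dilate 1 x + lambda_inv hp n%:R) =
    (\1_(@big_ball R p hp 0) x)%:C * (n == Ordinal mp)%:R.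
  have [xl x1] := @lambda_inv_digit R p hp n (ltn_ord n).
  have nE : (n == Ordinal mp) = (n%:R == - x 0).
    apply/eqP/eqP => [->|e]; first by rewrite natr_Zp.
    by apply/val_inj => /=; rewrite /m -e val_Zp_nat// modn_small.
  have -> : haar_phi (dilate 1 x + lambda_inv hp n%:R) =
      (((x \in @big_ball R p hp 0) && (n == Ordinal mp))%:R : R)%:C.
    rewrite /haar_phi indicE; congr (((_ : bool)%:R)%:C).
    rewrite nE; apply/idP/andP; rewrite !inE.
      move=> h; split.
        move=> i; rewrite oppr0 => i0; have i1 : i - 1 < 0 by lia.
        have i2 : i - 1 < - 1 by lia.
        by have := h _ i1; rewrite digitD xl// addr0/= subrK.
      have := h (- 1) isT.
      by rewrite digitD/= addNr x1 => /eqP; rewrite addrC addr_eq0.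
    move=> [h /eqP e] i i0; rewrite digitD/=.
    have [->|i1] := eqVneq i (- 1); first by rewrite addNr x1 e subrr.
    by rewrite xl ?addr0 ?h ?oppr0//; lia.
  by rewrite indicE; case: (_ \in _) => /=; rewrite ?mul0r ?mul1r//; case: eqP.
rewrite /haar_psi (bigD1 (Ordinal mp))// big1; last first.
  by move=> n ne; rewrite phiE (negbTE ne) !mulr0.
rewrite Monoid.mulm1 phiE eqxx mulr1 [LHS]mulrC; congr (_ * _).
rewrite chiC single_digitN chi_single subr0 opprK subrr mulrN -mulNr.
rewrite -[- x 0]natr_Zp -natrM zroot_nat// /unit_root (natrM R); congr expi.
by rewrite -/m /=; ring.
Qed.

Lemma big_ball_dilate j x : big_ball 0 (dilate j x) <-> big_ball (- j) x.
Proof.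
rewrite /big_ball oppr0 opprK; split=> h n nj /=; last by apply: h; lia.
by rewrite -[n](subrK j); apply: (h (n - j)); lia.
Qed.

Lemma dilate_freq j nu : dilate j (haar_freq 0 nu) = haar_freq j nu.
Proof.
apply: vilenkinP => i; rewrite [LHS]/(haar_freq 0 nu (i + j)) !single_digitE.
by congr (if _ then _ else _); lia.
Qed.

Lemma dilateDr j x y : dilate j (x + y) = dilate j x + dilate j y.
Proof. exact: vilenkinP. Qed.

Lemma dilateN j x : dilate j (- x) = - dilate j x.
Proof. exact: vilenkinP. Qed.

Lemma dilate_shift j k : dilate j (haar_shift j k) = lambda_inv hp k%:R.
Proof. by rewrite /haar_shift -dilateD subrr dilate0. Qed.

(** The argument of [haar_psi] is the dilation of [x + haar_shift j k]. Self-adjointness moves the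
    dilation to the frequency, and splitting the character leaves the constant phase. *)
Lemma haarE nu j k x : haar nu j k x = (p%:R `^ (j%:~R / 2))%:C *
  chi (haar_shift j k) (- haar_freq j nu) *
  wave (- j) (haar_shift j k) (- haar_freq j nu) x.
Proof.
rewrite /haar haar_psiE -(dilate_shift j k) addrC -dilateDr -mulrA.
congr (_ * _); rewrite /wave mulrCA; congr (_ * _).
  rewrite !indicE; congr ((nat_of_bool _)%:R)%:C.
  by apply/idP/idP; rewrite !inE => /big_ball_dilate.
rewrite chiC chi_dilate dilateN dilate_freq chiDl.
by congr (_ * _); rewrite chiC.
Qed.

(** No phase appears here: the one in [haarE] cancels against the one produced by
    [fourierL1_wave]. *)
Definition haar_dual nu j k w : R[i] := (p%:R `^ (- (j%:~R / 2)))%:C *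
  wave j (haar_freq j nu) (haar_shift j k) w.

Lemma powR_half j : p%:R `^ (- (j%:~R / 2)) * p%:R ^ j =
  p%:R `^ (j%:~R / 2) :> R.
Proof.
have -> : p%:R ^ j = p%:R `^ (j%:~R) :> R by rewrite powR_intmul.
rewrite -powRD; last by rewrite p_neq0 implybT.
by congr (_ `^ _); lra.
Qed.

Lemma powR_halfV j : p%:R `^ (j%:~R / 2) * p%:R ^ (- j) =
  p%:R `^ (- (j%:~R / 2)) :> R.
Proof. by rewrite -powR_half -mulrA -expfzDr// subrr expr0z mulr1. Qed.

Lemma powR_half_sqr j :
  p%:R `^ (- (j%:~R / 2)) * p%:R `^ (- (j%:~R / 2)) * p%:R ^ j = 1 :> R.
Proof.
rewrite -mulrA powR_half -powRD; last by rewrite p_neq0 implybT.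
by rewrite addNr powRr0.
Qed.

(** On the support, [w + haar_freq j nu] vanishes below index [-j], so the leading digit of [w] is
    [-nu], at [-1 - j]. *)
Lemma wave_freq nu j a w : (0 < nu < p)%N -> wave j (haar_freq j nu) a w != 0 ->
  [/\ forall i, i < - 1 - j -> w i = 0, w (- 1 - j) = - nu%:R &
      vnorm w = p%:R ^ (1 + j)].
Proof.
move=> /andP[nu0 nup]; rewrite waveE; case: ifPn; last by rewrite eqxx.
rewrite inE => h _.
have lo i : i < - 1 - j -> w i = 0.
  move=> ij; have := h i; rewrite digitD single_digitE ifF ?add0r; last by lia.
  by apply; lia.
have at1 : w (- 1 - j) = - nu%:R.
  have ij : - 1 - j < - j by lia.
  have := h _ ij; rewrite digitD single_digitE eqxx addrC => /eqP.
  by rewrite addr_eq0 => /eqP.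
have nuZ : nu%:R != 0 :> 'Z_p.
  apply/eqP => /(congr1 (@nat_of_ord _)); rewrite val_Zp_nat// modn_small//=.
  by lia.
have w0 : w != 0.
  by apply: contraNneq nuZ => w0; rewrite -oppr_eq0 -at1 w0 digit0.
split => //; rewrite /vnorm (negbTE w0); congr (_ ^ _).
have [wn wlo] := vorderP w0.
have [lt1|lt1|->] := ltgtP (vorder w) (- 1 - j); last by lia.
  by move: wn; rewrite lo ?eqxx.
by move: nuZ; rewrite -oppr_eq0 -at1 wlo ?eqxx.
Qed.

Lemma wave_disjoint nu j nu' j' a a' w : (0 < nu < p)%N -> (0 < nu' < p)%N ->
  (j, nu) != (j', nu') ->
  wave j (haar_freq j nu) a w * (wave j' (haar_freq j' nu') a' w)^*%C = 0.
Proof.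
move=> hnu hnu' ne.
have [->|/(wave_freq hnu)[_ w1 n1]] := eqVneq (wave j (haar_freq j nu) a w) 0.
  by rewrite mul0r.
have [->|/(wave_freq hnu')[_ w2 n2]] :=
  eqVneq (wave j' (haar_freq j' nu') a' w) 0.
  by rewrite conjc0 mulr0.
have jj : j = j'.
  have /eqP := n1; rewrite n2 => /eqP/(ieexprIz p_gt0) e.
  suff : 1 + j' = 1 + j by lia.
  by apply: e; rewrite gt_eqF// ltr1n.
move: ne; rewrite jj; case: eqP => // -[]; congr (_, _).
have := w1; rewrite jj w2 => /oppr_inj/(congr1 (@nat_of_ord _)).
by rewrite !val_Zp_nat// !modn_small//; lia.
Qed.

Variable mu : {measure set G -> \bar R}.
Hypothesis haar_mu : normalized_haar mu.

(** The conjugate character turns frequency [a] into [a - w]; the integral then vanishes unless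
    [a - w] lies in the dual ball, which cuts off [w] to a coset. *)
Lemma fourierL1_wave j b a w : fourierL1 mu (wave j b a) w =
  (p%:R ^ j)%:C * (chi a b)^*%C * wave (- j) (- a) b w.
Proof.
rewrite (_ : fourierL1 mu (wave j b a) w = cintegral mu (wave j b (a - w))).
  rewrite cintegral_wave// chiDl chiNl [X in _ * X]conjcM conjcK.
  rewrite /wave rmorphM [chi w b]chiC -!mulrA; congr (_ * _).
  rewrite mulrCA; congr (_ * (_ * _)).
  rewrite !indicE; congr ((nat_of_bool _)%:R)%:C.
  rewrite -[a - w]opprK opprB addrC.
  by apply/idP/idP; rewrite !inE => /big_ballN.
by apply: eq_cintegral => x; rewrite /wave -mulrA chiDl chiNl [chi x w]chiC.
Qed.

Lemma memL1_haar nu j k : memL1 mu (haar nu j k).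
Proof.
by rewrite (funext (haarE nu j k)); apply: memL1Z; exact: memL1_wave.
Qed.

Lemma memL2_haar nu j k : memL2 mu (haar nu j k).
Proof.
by rewrite (funext (haarE nu j k)); apply: memL2Z; exact: memL2_wave.
Qed.

Lemma memL1_dual nu j k : memL1 mu (haar_dual nu j k).
Proof. by apply: memL1Z; exact: memL1_wave. Qed.

Lemma memL2_dual nu j k : memL2 mu (haar_dual nu j k).
Proof. by apply: memL2Z; exact: memL2_wave. Qed.

Lemma fourierL1Z r u w : (forall w, memL1 mu (fun x => u x * (chi x w)^*%C)) ->
  fourierL1 mu (fun x => r * u x) w = r * fourierL1 mu u w.
Proof.
move=> hu; rewrite /fourierL1 -cintegralZ//.
by apply: eq_cintegral => x; rewrite mulrA.
Qed.

Lemma memL1_wave_chi j b a w :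
  memL1 mu (fun x => wave j b a x * (chi x w)^*%C).
Proof.
rewrite (_ : (fun _ => _) = wave j b (a - w)); first exact: memL1_wave.
by apply/funext => x; rewrite /wave -mulrA chiDl chiNl [chi x w]chiC.
Qed.

Lemma fourierL1_haar nu j k : fourierL1 mu (haar nu j k) = haar_dual nu j k.
Proof.
apply/funext => w; rewrite (funext (haarE nu j k)) fourierL1Z; last first.
  by move=> ?; exact: memL1_wave_chi.
rewrite fourierL1_wave !opprK /haar_dual !mulrA; congr (_ * _).
rewrite -powR_halfV rmorphM -!mulrA; congr (_ * _).
by rewrite mulrCA; congr (_ * _); rewrite mulrA chiC chi_conj mul1r.
Qed.

(** Fourier inversion, obtained by transforming the explicit wave a second time. It puts a Haar
    function into the form required by [parsevalL1]. *)
Lemma haar_inversion nu j k x :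
  haar nu j k x = fourierL1 mu (haar_dual nu j k) (- x).
Proof.
rewrite fourierL1Z; last by move=> ?; exact: memL1_wave_chi.
rewrite fourierL1_wave haarE -powR_half rmorphM chiNr -!mulrA.
congr (_ * (_ * (_ * _))); rewrite /wave chiNl chiNr; congr (_ * _).
rewrite !indicE -opprD; congr ((nat_of_bool _)%:R)%:C.
by apply/idP/idP; rewrite !inE => /big_ballN.
Qed.

(** For equal [(j, nu)] the product is a wave whose frequency is the difference of the shifts. Its
    integral survives only if that difference lies in [big_ball (- j)], and after dilation this
    forces [k = k']. *)
Lemma ip_dual nu j k nu' j' k' : (0 < nu < p)%N -> (0 < nu' < p)%N ->
  ip mu (haar_dual nu j k) (haar_dual nu' j' k') =
  ((nu, j, k) == (nu', j', k'))%:R.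
Proof.
move=> hnu hnu'; have [[<- <-]|ne] := eqVneq (j, nu) (j', nu'); last first.
  have -> : ((nu, j, k) == (nu', j', k')) = false.
    by apply/negP => /eqP[e1 e2 _]; move: ne; rewrite e1 e2 eqxx.
  rewrite /ip (@eq_cintegral _ _ _ _ _ (fun x => 0 * wave 0 0 0 x)).
    by rewrite cintegralZ ?mul0r//; exact: memL1_wave.
  move=> w; rewrite /haar_dual conjcM mulrACA mul0r.
  by rewrite (wave_disjoint (nu := nu))// mulr0.
rewrite /ip (@eq_cintegral _ _ _ _ _
    (fun w => (p%:R `^ (- (j%:~R / 2)) * p%:R `^ (- (j%:~R / 2)))%:C *
      wave j (haar_freq j nu) (haar_shift j k - haar_shift j k') w));
    last first.
  move=> w; rewrite /haar_dual conjcM mulrACA conjc_real -rmorphM.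
  congr (_ * _); rewrite !waveE; case: ifP; rewrite ?mul0r//.
  by rewrite chiDl chiNl.
rewrite cintegralZ; last exact: memL1_wave.
rewrite cintegral_wave// !xpair_eqE !eqxx !andTb.
have [->|kk] := eqVneq k k'.
  rewrite subrr chi0l conjc1 mulr1 indicE mem_set// mulr1 -rmorphM.
  by rewrite powR_half_sqr.
rewrite indicE memNset ?mulr0 ?mul0r ?mulr0// => h.
move/eqP: kk; apply; apply: (@lambda_inv_inj R p hp).
by rewrite -!(dilate_shift j) -dilateN -dilateDr; apply/big_ball_dilate.
Qed.

End HaarFourier.

(** * Haar coefficients as inner products, Parseval in L2 and the final bound *)

Section HaarCoefficients.
Variables (R : realType) (p : nat) (hp : (1 < p)%N).
Local Notation G := (vilenkin R hp).
Variable mu : {measure set G -> \bar R}.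
Hypothesis haar_mu : normalized_haar mu.
Implicit Types (f g u v : G -> R[i]).

Let p_gt0 : 0 < p%:R :> R. Proof. by rewrite ltr0n (ltn_trans _ hp). Qed.

Lemma normalized_haar_sigma_finite : sigma_finite setT mu.
Proof.
exists (fun n : nat => @big_ball R p hp n%:Z).
  apply/seteqP; split => // x _; have [N xN] := digits_lt x.
  by exists N.
move=> n; split; first exact: measurable_big_ball.
by rewrite mu_big_ball// ltry.
Qed.

Lemma cmeas_fourier u : memL1 mu u -> cmeas (fourierL1 mu u).
Proof.
have [m <-] := sigma_finite_measureP normalized_haar_sigma_finite.
by move=> hu; apply: cmeas_fourierL1; exact: memL1_cmeas hu.
Qed.

Lemma parseval_haar u nu j k : memL1 mu u ->
  ip mu u (haar nu j k) = ip mu (fourierL1 mu u) (haar_dual nu j k).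
Proof.
move=> hu; rewrite /ip.
under eq_cintegral => x do rewrite (haar_inversion haar_mu).
move: hu (memL1_dual haar_mu nu j k).
have [m <-] := sigma_finite_measureP normalized_haar_sigma_finite.
exact: parsevalL1.
Qed.

Lemma ip_haar nu j k nu' j' k' : (0 < nu < p)%N -> (0 < nu' < p)%N ->
  ip mu (haar nu j k) (haar nu' j' k') = ((nu, j, k) == (nu', j', k'))%:R.
Proof.
move=> hnu hnu'; rewrite parseval_haar ?(fourierL1_haar haar_mu) ?ip_dual//.
exact: memL1_haar.
Qed.

Lemma L2norm_cvg0_lt T (F : set_system T) (u : T -> \bar R) (e : R) :
  u t @[t --> F] --> 0%E -> 0 < e -> \forall t \near F, (u t < e%:E)%E.
Proof.
move=> uF e0; apply: (uF [set x | (x < e%:E)%E]); apply: open_nbhs_nbhs.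
by split; [exact: open_ereal_lt_ereal|rewrite /= lte_fin].
Qed.

Lemma normc_eq0_ball (z : R[i]) (C : R) : 0 <= C ->
  (forall e : R, 0 < e -> Normc.normc z <= e * C) -> z = 0.
Proof.
move=> C0 h; apply: Normc.eq0_normc; apply/eqP; rewrite eq_le normc_ge0 andbT.
apply/ler_addgt0Pl => e e0; rewrite addr0.
have C1 : 0 < C + 1 by rewrite ltr_wpDl.
apply: le_trans (h (e / (C + 1)) _) _; first by rewrite divr_gt0.
by rewrite mulrAC ler_pdivrMr// ler_pM2l// lerDl.
Qed.

Lemma ip_small u v (e : R) : memL2 mu u -> memL2 mu v ->
  (L2norm mu u < e%:E)%E ->
  Normc.normc (ip mu u v) <= e * (2 * fine (L2norm mu v)).
Proof.
move=> hu hv ue; have [_ _ vlt] := hv.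
rewrite -lee_fin (le_trans (normc_ip_le hu hv))//.
rewrite mulrCA !EFinM fineK ?ge0_fin_numE ?L2norm_ge0//.
by rewrite lee_pmul2l// lee_wpmul2r ?L2norm_ge0// ltW.
Qed.

(** A partial sum containing the index [(nu, j, k)] has inner product exactly [c nu j k] with the
    Haar function, and such sums come arbitrarily close to [f]. *)
Lemma haar_coefficient f (c : nat -> int -> nat -> R[i]) nu j k :
  memL2 mu f -> is_haar_expansion mu f c -> (0 < nu < p)%N ->
  c nu j k = ip mu f (haar nu j k).
Proof.
move=> hf hexp hnu; apply/eqP; rewrite eq_sym -subr_eq0; apply/eqP.
have hh := memL2_haar haar_mu nu j k.
apply: (@normc_eq0_ball _ (2 * fine (L2norm mu (haar nu j k)))).
  by rewrite mulr_ge0// fine_ge0// L2norm_ge0.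
move=> e e0.
pose S (A : {fset nat * int * nat}) (x : G) :=
  \sum_(i <- A | (0 < i.1.1 < p)%N) c i.1.1 i.1.2 i.2 * haar i.1.1 i.1.2 i.2 x.
have [A Ae] : exists A : {fset nat * int * nat}, (nu, j, k) \in A /\
    (L2norm mu (fun x => f x - S A x)%R < e%:E)%E.
  have [B _ Be] := L2norm_cvg0_lt hexp e0.
  (* Convergence along finite sets ordered by inclusion allows the wanted index to be added to
     [B]. *)
  exists ((nu, j, k) |` B)%fset; split; first by rewrite !inE eqxx.
  by apply: Be => /=; exact: fsubsetUr.
have hS : memL2 mu (S A).
  by apply: memL2_sum => i _; apply: memL2Z; exact: memL2_haar.
suff <- : ip mu (fun x => f x - S A x) (haar nu j k) =
    ip mu f (haar nu j k) - c nu j k.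
  exact: (ip_small (memL2B hf hS) hh Ae.2).
rewrite ipBl//; congr (_ - _); rewrite ip_suml//; last first.
  by move=> i _; apply: memL2Z; exact: memL2_haar.
have ipE i : (0 < i.1.1 < p)%N ->
    ip mu (fun x => c i.1.1 i.1.2 i.2 * haar i.1.1 i.1.2 i.2 x) (haar nu j k) =
    c i.1.1 i.1.2 i.2 * (i == (nu, j, k))%:R.
  move=> hi; rewrite ipZl//; last exact: memL2_haar.
  by rewrite ip_haar//; case: i hi => -[].
rewrite (eq_bigr _ ipE) big_mkcond (bigD1_seq _ Ae.1 (fset_uniq A))/=.
rewrite hnu eqxx mulr1 big1 ?addr0// => i /negbTE ->.
by rewrite mulr0; case: ifP.
Qed.

Lemma parseval_haarL2 f g nu j k : memL2 mu f -> is_fourierL2 mu f g ->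
  ip mu f (haar nu j k) = ip mu g (haar_dual nu j k).
Proof.
move=> hf [hg [fn [hfn fnf fng]]].
have hh := memL2_haar haar_mu nu j k; have hd := memL2_dual haar_mu nu j k.
apply/eqP; rewrite -subr_eq0; apply/eqP.
pose C := 2 * fine (L2norm mu (haar nu j k)) +
          2 * fine (L2norm mu (haar_dual nu j k)).
apply: (@normc_eq0_ball _ C).
  by rewrite addr_ge0// mulr_ge0// fine_ge0// L2norm_ge0.
move=> e e0.
have [n [ne ge]] : exists n,
    (L2norm mu (fn n \- f)%R < e%:E)%E /\
    (L2norm mu (fourierL1 mu (fn n) \- g)%R < e%:E)%E.
  have [n [? ?]] := filter_ex (filterI (L2norm_cvg0_lt fnf e0)
    (L2norm_cvg0_lt fng e0)).
  by exists n.
have [h1 h2] := hfn n.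
(* Square integrability of the transform of [fn n] is read off from its finite distance to [g]. *)
have hF : memL2 mu (fun x => fourierL1 mu (fn n) x - g x).
  have [rF iF] : cmeas (fun x => fourierL1 mu (fn n) x - g x).
    under eq_fun do rewrite -[X in _ + X]mulN1r.
    apply: cmeasD; first exact: cmeas_fourier.
    by apply: cmeasM; [exact: cmeas_cst|exact: memL2_cmeas hg].
  by split => //; apply: lt_trans ge _; exact: ltry.
have hFn : memL2 mu (fourierL1 mu (fn n)).
  by have := memL2D hF hg; under eq_fun do rewrite subrK.
(* Parseval for the integrable [fn n] cancels its two inner products, leaving two errors that are
   both small. *)
have -> : ip mu f (haar nu j k) - ip mu g (haar_dual nu j k) =
    ip mu (fun x => fourierL1 mu (fn n) x - g x) (haar_dual nu j k) -
    ip mu (fun x => fn n x - f x) (haar nu j k).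
  rewrite !ipBl// (parseval_haar nu j k h1).
  by rewrite opprB [RHS]addrC addrA subrK.
apply: le_trans (le_normcD _ _) _; rewrite normcN mulrDr [leRHS]addrC.
apply: lerD; first exact: (ip_small hF hd ge).
exact: (ip_small (memL2B h2 hf) hh ne).
Qed.

Lemma ip_vnorm_dual g nu j k : (0 < nu < p)%N -> memL2 mu g ->
  ip mu (fun w => (vnorm w)%:C * g w) (haar_dual nu j k) =
  (p%:R ^ (1 + j))%:C * ip mu g (haar_dual nu j k).
Proof.
move=> hnu hg; have hd := memL2_dual haar_mu nu j k.
rewrite -ipZl//; apply: eq_cintegral => w; rewrite /haar_dual.
have [->|w0] := eqVneq (wave j (haar_freq R hp j nu) (haar_shift R hp j k) w) 0.
  by rewrite mulr0 conjc0 !mulr0.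
by have [_ _ ->] := wave_freq hnu w0.
Qed.

(** The factor [p ^- 2] compensates the shell value [p ^ (1 + j)] against the weight [p ^ j]. The
    bound does not depend on [r], so it passes to the supremum over finite sets. *)
Lemma haar_coefficient_bound f g (c : nat -> int -> nat -> R[i]) nu
    (r : seq (int * nat)) :
  memL2 mu f -> is_fourierL2 mu f g ->
  memL2 mu (fun w => (vnorm w)%:C * g w) -> is_haar_expansion mu f c ->
  (0 < nu < p)%N -> uniq r ->
  \sum_(i <- r) Normc.normc ((p%:R ^ i.1)%:C * c nu i.1 i.2) ^+ 2 <=
  p%:R ^- 2 * complex.Re (ip mu (fun w => (vnorm w)%:C * g w)
                                (fun w => (vnorm w)%:C * g w)).
Proof.
move=> hf hfg hh hexp hnu ur.
have hg : memL2 mu g by case: hfg.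
have p2 : 0 < p%:R ^+ 2 :> R by rewrite exprn_gt0.
rewrite ler_pdivlMl// mulr_sumr.
have ortho : {in r &, forall i i' : int * nat,
    ip mu (@haar_dual R p hp nu i.1 i.2) (@haar_dual R p hp nu i'.1 i'.2) =
    (i == i')%:R}.
  by move=> [j k] [j' k'] _ _; rewrite ip_dual// !xpair_eqE eqxx.
apply: le_trans (bessel ur hh (fun i _ => memL2_dual haar_mu nu i.1 i.2) ortho).
rewrite le_eqVlt; apply/orP; left; apply/eqP; apply: eq_bigr => i _.
rewrite ip_vnorm_dual// (haar_coefficient _ _ hf hexp)//.
rewrite (parseval_haarL2 _ _ _ hf hfg) !Normc.normcM !normcC !exprMn mulrA.
congr (_ * _); rewrite !real_normK ?num_real// expfzDr ?gt_eqF// expr1z.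
by rewrite exprMn.
Qed.

End HaarCoefficients.

Theorem corollary2 (R : realType) (p : nat) (hp : (1 < p)%N)
    (mu : {measure set (vilenkin R hp) -> \bar R})
    (f Ff : vilenkin R hp -> R[i]) (c : nat -> int -> nat -> R[i]) :
  normalized_haar mu ->
  memL2 mu f ->
  is_fourierL2 mu f Ff ->
  memL2 mu (fun w => (vnorm w)%:C * Ff w) ->
  is_haar_expansion mu f c ->
  (\sum_(1 <= nu < p) \esum_(j in [set: int]) \esum_(k in [set: nat])
     ((Normc.normc ((p%:R ^ j)%:C * c nu j k)) ^+ 2)%:E < +oo)%E.
Proof.
move=> haar_mu hf hfg hh hexp.
(* There are finitely many [nu], so each may be bounded separately. *)
rewrite big_nat_cond; apply: lte_sum_pinfty => nu; rewrite andbT => hnu.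
(* Merging the two sums makes the value a supremum over finite sets of pairs [(j, k)], to which
   Bessel applies. *)
rewrite esum_esum; last by move=> j k _ _; rewrite lee_fin sqr_ge0.
apply: (@le_lt_trans _ _ (p%:R ^- 2 * complex.Re (ip mu
    (fun w => (vnorm w)%:C * Ff w) (fun w => (vnorm w)%:C * Ff w)))%:E).
  apply: ge_ereal_sup => _ [A [finA _] <-].
  rewrite fsbig_finite// sumEFin lee_fin.
  exact: (haar_coefficient_bound haar_mu hf hfg hh hexp hnu (fset_uniq _)).
exact: ltry.
Qed.
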